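(* Let $m,n\ge 0$ be integers and let $x,y,z,t$, $a_1,\dotsc,a_m$ and $b_1,\dotsc,b_n$ be non-negative integers. Then $$\operatorname{M}\big(P_{x,y,z,t}(a_1,\dotsc,a_m;b_1,\dotsc,b_n)\big)=\Phi_{x,y,z,t}(a_1,\dotsc,a_m;b_1,\dotsc,b_n)$$ and $$\operatorname{M}\big(Q_{x,y,z,t}(a_1,\dotsc,a_m;b_1,\dotsc,b_n)\big)=\Psi_{x,y,z,t}(a_1,\dotsc,a_m;b_1,\dotsc,b_n).$$
   Context: Tilings. Consider the triangular lattice drawn so that one family of lattice lines is horizontal. A lozenge is the union of two unit triangles sharing an edge; a lozenge tiling of a lattice region is a covering of it by lozenges lying in it, with no gaps or overlaps. $\operatorname{M}(R)$ denotes the number of lozenge tilings of the region $R$. Side-lengths of a hexagon on this lattice are listed clockwise starting from the northwestern side (NW, N, NE, SE, S, SW). Notation. $o_a=a_1+a_3+a_5+\cdots$, $e_a=a_2+a_4+\cdots$, $o_b=b_1+b_3+b_5+\cdots$, $e_b=b_2+b_4+\cdots$, $a=a_1+a_2+\cdots$, $b=b_1+b_2+\cdots$. Ferns. A fern is a string of contiguous equilateral lattice triangles (lobes) of alternating orientations lined up along a common horizontal lattice line (the axis): consecutive lobes touch at a point of the axis, each lobe has one side on the axis, up-pointing lobes lie above the axis and down-pointing lobes lie below it. Lobes may have side-length $0$ (empty). The region $P_{x,y,z,t}(a_1,\dotsc,a_m;b_1,\dotsc,b_n)$. Start with the hexagon of side-lengths $x+y+o_a+o_b,\ z+e_a+e_b,\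 y+t+o_a+o_b,\ x+y+e_a+e_b,\ z+o_a+o_b,\ y+t+e_a+e_b$. The axis is the horizontal lattice line that is $x$ units (lattice rows) above the western vertex and, equivalently, $t$ units above the eastern vertex. Along it remove two ferns: a left fern whose leftmost point is where the axis meets the northwestern side, with lobes of side-lengths $a_1,a_2,\dotsc,a_m$ from left to right, the lobe of side $a_i$ pointing up for $i$ odd and down for $i$ even; and a right fern whose rightmost point is where the axis meets the northeastern side, with lobes of side-lengths $b_1,\dotsc,b_n$ from right to left, the lobe of side $b_i$ pointing up for $i$ odd and down for $i$ even. (The distance between the two ferns is $y+z$.) The region $Q_{x,y,z,t}(a_1,\dotsc,a_m;b_1,\dotsc,b_n)$. Start with the hexagon of side-lengths $x+y+t+o_a+e_b,\ z+e_a+o_b,\ y+o_a+e_b,\ x+y+t+e_a+o_b,\ z+o_a+e_b,\ y+e_a+o_b$. The axis is the horizontal lattice line that is $x$ units above the western vertex and, equivalently, $t$ units below the eastern vertex. Along it remove a left fern whose leftmost point is where the axis meets the northwestern side, with lobes $a_1,\dotsc,a_m$ from left to right, the lobe of side $a_i$ pointing up for $i$ odd and down for $i$ even; and a right fern whose rightmost point is where the axis meets the southeastern side, with lobes $b_1,\dotsc,b_n$ from right to left, the lobe of side $b_i$ pointing down for $i$ odd and up for $i$ even. (The distance between the two ferns is again $y+z$.) Hyperfactorial. $\operatorname{H}(n)=0!\,1!\,2!\cdots(n-1)!$ (so $\operatorname{H}(0)=1$). The function $s$. For a list of non-negative integers of odd length, $$s(c_1,\dots,c_{2r-1})=\frac{1}{\operatorname{H}(c_1+c_3+\cdots+c_{2r-1})}\cdot\frac{\prod_{1\le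 i\le j\le 2r-1,\ j-i+1\text{ odd}}\operatorname{H}(c_i+c_{i+1}+\cdots+c_j)}{\prod_{1\le i\le j\le 2r-1,\ j-i+1\text{ even}}\operatorname{H}(c_i+c_{i+1}+\cdots+c_j)}.$$ The functions $\Phi$ and $\Psi$. For lists of even lengths, $$\begin{aligned}\Phi_{x,y,z,t}&(a_1,\dotsc,a_{2l};b_1,\dotsc,b_{2k})= s(a_1,\dotsc,a_{2l-1},a_{2l}+y+z+b_{2k},b_{2k-1},\dotsc,b_1)\\&\times s(x,a_1,\dotsc,a_{2l},y+z,b_{2k},\dotsc,b_1,t)\\&\times\frac{\operatorname{H}(y)\operatorname{H}(z)\operatorname{H}(a+b+x+2y+z+t)}{\operatorname{H}(y+z)\operatorname{H}(a+b+x+2y+t)}\cdot\frac{\operatorname{H}(a+b+x+y+t)}{\operatorname{H}(a+b+x+y+z+t)}\\&\times\frac{\operatorname{H}(a+x+y)\operatorname{H}(b+y+t)}{\operatorname{H}(a+x)\operatorname{H}(b+t)}\cdot\frac{\operatorname{H}(e_a+e_b+x+t)\operatorname{H}(o_a+o_b)}{\operatorname{H}(e_a+e_b+x+y+t)\operatorname{H}(o_a+o_b+y)},\end{aligned}$$ $$\begin{aligned}\Psi_{x,y,z,t}&(a_1,\dotsc,a_{2l};b_1,\dotsc,b_{2k})= s(a_1,\dotsc,a_{2l-1},a_{2l}+y+z,b_{2k},\dotsc,b_1,t)\\&\times s(x,a_1,\dotsc,a_{2l},y+z+b_{2k},b_{2k-1},\dotsc,b_1)\\&\times\frac{\operatorname{H}(y)\operatorname{H}(z)\operatorname{H}(a+b+x+2y+z+t)}{\operatorname{H}(y+z)\operatorname{H}(a+b+x+2y+t)}\cdot\frac{\operatorname{H}(a+b+x+y+t)}{\operatorname{H}(a+b+x+y+z+t)}\\&\times\frac{\operatorname{H}(a+x+y)\operatorname{H}(b+y+t)}{\operatorname{H}(a+x)\operatorname{H}(b+t)}\cdot\frac{\operatorname{H}(e_a+o_b+x)\operatorname{H}(o_a+e_b+t)}{\operatorname{H}(e_a+o_b+x+y)\operatorname{H}(o_a+e_b+y+t)}.\end{aligned}$$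 If the list $a_1,\dotsc,a_m$ (respectively $b_1,\dotsc,b_n$) has odd length, $\Phi$ and $\Psi$ are defined by appending a $0$ at the end of that list; an empty list is read as the list $(0,0)$. *)

(* Defs.v *)
From HB Require Import structures.
From mathcomp Require Import all_boot all_order all_algebra.
From mathcomp Require Import finmap zify.

Set Implicit Arguments.
Unset Strict Implicit.
Unset Printing Implicit Defensive.

Import Order.TTheory GRing.Theory Num.Theory.

(** The triangular lattice.  The pair [(i, j)] is the lattice point
    [i * e1 + j * e2] with [e1 = (1, 0)] and [e2 = (1/2, sqrt 3 / 2)], so that
    [j] is the height counted in lattice rows. *)

Definition point : Type := (int * int)%type.

(** [((i, j), true)] is the up-pointing unit triangle with lower left vertex
    [(i, j)]; [((i, j), false)] is the down-pointing one that shares its right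
    side, so that the two make up the parallelogram spanned by [e1] and [e2] at
    [(i, j)]. *)

Definition triangle : Type := (point * bool)%type.

Definition vertices (u : triangle) : seq point :=
  (let: ((i, j), up) := u in
   if up then [:: (i, j); (i + 1, j); (i, j + 1)]
   else [:: (i, j + 1); (i + 1, j); (i + 1, j + 1)])%R.

Definition share_edge (u v : triangle) : bool :=
  (u != v) && (count [in vertices u] (vertices v) == 2).

(** Only used for convex lattice polygons [A], which contain a unit triangle if
    and only if they contain its vertices. *)

Definition inside (A : pred point) (u : triangle) : bool := all A (vertices u).

(** Tilings of a finite set of unit triangles. *)

Definition lozenge (R : {fset triangle}) (L : {set R}) : bool :=
  [exists u : R, [exists v : R,
    share_edge (val u) (val v) && (L == [set u; v]%SET)]].

Definition tiling (R : {fset triangle}) (T : {set {set R}}) : bool :=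
  partition T [set: R]%SET && [forall L in T, lozenge L].

Definition M (R : {fset triangle}) : nat :=
  #|[set T : {set {set R}} | tiling T]%SET|.

(** Hexagons.  The sides are listed clockwise from the northwestern one, and
    the western vertex is the origin. *)

Definition side_dirs : seq point :=
  [:: (0, 1); (1, 0); (1, -1); (0, -1); (-1, 0); (-1, 1)]%R.

Definition corner (l : seq nat) (k : nat) : point :=
  (\sum_(i < k) nth 0 side_dirs i *+ nth 0%N l i)%R.

(** The basis [(e1, e2)] being direct, a point lies to the right of a directed
    line (or on it) when this determinant is nonpositive. *)

Definition right_of (d c p : point) : bool :=
  (d.1 * (p.2 - c.2) - d.2 * (p.1 - c.1) <= 0)%R.

Definition in_hexagon (l : seq nat) (p : point) : bool :=
  all (fun k => right_of (nth 0%R side_dirs k) (corner l k) p) (iota 0 6).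

(** Lobes of side [c] whose horizontal side has left end [p]. *)

Definition in_lobe (up : bool) (p : point) (c : nat) (q : point) : bool :=
  (if up then [&& p.1 <= q.1, p.2 <= q.2 & q.1 + q.2 <= p.1 + p.2 + c%:Z]
   else [&& q.1 <= p.1 + c%:Z, q.2 <= p.2 & p.1 + p.2 <= q.1 + q.2])%R.

(** [up] is the orientation of the first lobe of the list, which is the leftmost
    one in [in_left_fern] (the fern starts at [p] and extends to the right) and
    the rightmost one in [in_right_fern] (the fern extends to the left of
    [p]). *)

Definition in_left_fern (up : bool) (p : point) (c : seq nat) (u : triangle) :=
  has (fun i => inside (in_lobe (up (+) odd i)
                          (p.1 + (sumn (take i c))%:Z, p.2)%R (nth 0 c i)) u)
      (iota 0 (size c)).

Definition in_right_fern (up : bool) (p : point) (c : seq nat) (u : triangle) :=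
  has (fun i => inside (in_lobe (up (+) odd i)
                          (p.1 - (sumn (take i.+1 c))%:Z, p.2)%R (nth 0 c i)) u)
      (iota 0 (size c)).

(** The sums of the terms with odd and even ranks; ranks start from 1. *)

Definition osum (c : seq nat) : nat := \sum_(i < size c | ~~ odd i) nth 0 c i.
Definition esum (c : seq nat) : nat := \sum_(i < size c | odd i) nth 0 c i.

(** All the unit triangles of the cells [(i, j)] with [-N <= i, j < N]. *)

Definition box (N : nat) : {fset triangle} :=
  [fset u in [seq (p, up) | p <- [seq (i%:Z - N%:Z, j%:Z - N%:Z)%R
                                   | i <- iota 0 N.*2, j <- iota 0 N.*2],
                            up <- [:: true; false]]]%fset.

Definition hexagon (l : seq nat) : {fset triangle} :=
  [fset u in box (sumn l) | inside (in_hexagon l) u]%fset.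

(** The box is large enough to lose no triangle of a hexagon whose boundary
    closes up. *)

Lemma corner0 l : corner l 0 = 0%R.
Proof. by rewrite /corner big_ord0. Qed.

Lemma cornerS l k :
  corner l k.+1 = (corner l k + nth 0 side_dirs k *+ nth 0%N l k)%R.
Proof. by rewrite /corner big_ord_recr. Qed.

Lemma mulrn_point (p : point) k :
  (p *+ k = (p.1 * k%:Z, p.2 * k%:Z))%R.
Proof.
elim: k => [|k IHk]; first by rewrite mulr0n !mulr0.
rewrite mulrS IHk; case: p {IHk} => i j /=; congr pair => /=; lia.
Qed.

Lemma mem_box N (i j : int) up :
  (((i, j), up) \in box N) =
  (- N%:Z <= i < N%:Z)%R && (- N%:Z <= j < N%:Z)%R.
Proof.
rewrite in_fset -[in_mem _ _]/(_ \in allpairs_dep _ _ _).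
apply/allpairsP/idP => [[[q b] /= [/allpairsP[[k l]]]]|].
  rewrite !mem_iota /= => -[hk hl -> _ [-> -> _]]; lia.
move=> ij; exists ((i, j), up); split=> //=; last by case: up.
apply/allpairsP; exists (absz (i + N%:Z)%R, absz (j + N%:Z)%R).
rewrite !mem_iota /=; split; [lia | lia |].
congr pair; lia.
Qed.

Lemma mem_hexagon (l : seq nat) (u : triangle) :
  size l = 6 -> corner l 6 = 0%R ->
  (u \in hexagon l) = inside (in_hexagon l) u.
Proof.
case: l => [|l0 [|l1 [|l2 [|l3 [|l4 [|l5 [|l6 l]]]]]]] // _.
case: u => [[i j] up] closed; rewrite [LHS]in_fset [LHS]inE mem_box /=.
apply: andb_idl; move: closed.
rewrite /inside /in_hexagon /right_of /= !cornerS corner0 !mulrn_point /=.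
by case=> h1 h2; case: up => /=; lia.
Qed.

(** The regions [P] and [Q]. *)

Definition P_sides (x y z t : nat) (a b : seq nat) : seq nat :=
  [:: x + y + osum a + osum b; z + esum a + esum b; y + t + osum a + osum b;
      x + y + esum a + esum b; z + osum a + osum b; y + t + esum a + esum b].

Definition P_left (x : nat) : point := (0, x%:Z)%R.

(** On the line of the northeastern side the sum of the coordinates is
    constant. *)

Definition P_right (x y z t : nat) (a b : seq nat) : point :=
  let c := corner (P_sides x y z t a b) 2 in (c.1 + c.2 - x%:Z, x%:Z)%R.

Definition P (x y z t : nat) (a b : seq nat) : {fset triangle} :=
  [fset u in hexagon (P_sides x y z t a b)
     | ~~ in_left_fern true (P_left x) a u
     & ~~ in_right_fern true (P_right x y z t a b) b u]%fset.

Definition Q_sides (x y z t : nat) (a b : seq nat) : seq nat :=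
  [:: x + y + t + osum a + esum b; z + esum a + osum b; y + osum a + esum b;
      x + y + t + esum a + osum b; z + osum a + esum b; y + esum a + osum b].

Definition Q_left (x : nat) : point := (0, x%:Z)%R.

(** On the line of the southeastern side the first coordinate is constant. *)

Definition Q_right (x y z t : nat) (a b : seq nat) : point :=
  ((corner (Q_sides x y z t a b) 3).1, x%:Z)%R.

Definition Q (x y z t : nat) (a b : seq nat) : {fset triangle} :=
  [fset u in hexagon (Q_sides x y z t a b)
     | ~~ in_left_fern true (Q_left x) a u
     & ~~ in_right_fern false (Q_right x y z t a b) b u]%fset.

Lemma corner_P (x y z t : nat) (a b : seq nat) :
  corner (P_sides x y z t a b) 6 = 0%R /\
  (corner (P_sides x y z t a b) 3).2 = (x%:Z - t%:Z)%R.
Proof.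
by rewrite !cornerS corner0 !mulrn_point /=; split; first congr pair=> /=; lia.
Qed.

Lemma corner_Q (x y z t : nat) (a b : seq nat) :
  corner (Q_sides x y z t a b) 6 = 0%R /\
  (corner (Q_sides x y z t a b) 3).2 = (x%:Z + t%:Z)%R.
Proof.
by rewrite !cornerS corner0 !mulrn_point /=; split; first congr pair=> /=; lia.
Qed.

(** The product formulas. *)

Definition hyperfact (n : nat) : nat := \prod_(i < n) i`!.

Local Notation H n := ((hyperfact n%N)%:R : rat)%R.

Definition csum (c : seq nat) (i j : nat) : nat :=
  \sum_(i <= k < j.+1) nth 0 c k.

Definition s (c : seq nat) : rat :=
  ((H (osum c))^-1 *
   ((\prod_(j < size c) \prod_(i < j.+1 | odd (j - i).+1) H (csum c i j)) /
    (\prod_(j < size c) \prod_(i < j.+1 | ~~ odd (j - i).+1) H (csum c i j))))%R.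

Definition even_pad (c : seq nat) : seq nat :=
  if c is [::] then [:: 0; 0] else if odd (size c) then rcons c 0 else c.

Definition but_last (c : seq nat) : seq nat := take (size c).-1 c.

Definition Phi_even (x y z t : nat) (a b : seq nat) : rat :=
  let A := sumn a in let B := sumn b in
  (s (but_last a ++ (last 0 a + y + z + last 0 b)%N :: rev (but_last b)) *
   s (x :: a ++ (y + z)%N :: rcons (rev b) t) *
   ((H y * H z * H (A + B + x + 2 * y + z + t)) /
    (H (y + z) * H (A + B + x + 2 * y + t))) *
   (H (A + B + x + y + t) / H (A + B + x + y + z + t)) *
   ((H (A + x + y) * H (B + y + t)) / (H (A + x) * H (B + t))) *
   ((H (esum a + esum b + x + t) * H (osum a + osum b)) /
    (H (esum a + esum b + x + y + t) * H (osum a + osum b + y))))%R.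

Definition Psi_even (x y z t : nat) (a b : seq nat) : rat :=
  let A := sumn a in let B := sumn b in
  (s (but_last a ++ (last 0 a + y + z)%N :: rcons (rev b) t) *
   s (x :: a ++ (y + z + last 0 b)%N :: rev (but_last b)) *
   ((H y * H z * H (A + B + x + 2 * y + z + t)) /
    (H (y + z) * H (A + B + x + 2 * y + t))) *
   (H (A + B + x + y + t) / H (A + B + x + y + z + t)) *
   ((H (A + x + y) * H (B + y + t)) / (H (A + x) * H (B + t))) *
   ((H (esum a + osum b + x) * H (osum a + esum b + t)) /
    (H (esum a + osum b + x + y) * H (osum a + esum b + y + t))))%R.

Definition Phi (x y z t : nat) (a b : seq nat) : rat :=
  Phi_even x y z t (even_pad a) (even_pad b).

Definition Psi (x y z t : nat) (a b : seq nat) : rat :=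
  Psi_even x y z t (even_pad a) (even_pad b).

(* Main.v *)
Require Import Defs.
From HB Require Import structures.
From mathcomp Require Import all_boot all_order all_algebra.
From mathcomp Require Import finmap zify ring.

Set Implicit Arguments.
Unset Strict Implicit.
Unset Printing Implicit Defensive.

Import Order.TTheory GRing.Theory Num.Theory.

(** Cut the region along the axis.  A tiling is determined by the set [S] of the
    [y] unit segments of the gap that are crossed by lozenges, together with a
    tiling of either half.  Every lobe may be replaced by unit dents along the
    axis, because the lozenges inside it are then forced, and so may the
    triangles that complete either half into a trapezoid; hence both halves
    become trapezoids with unit dents.  A trapezoid with dents [D] has
    [Delta(D) / H(|D|)] tilings, [Delta] being the Vandermonde product (proved by
    peeling off rows and telescoping a determinant of falling factorials).  If
    [U] and [V] are the dents of the upper and lower halves off the gap, then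
    [M = sum_S Delta(U + S) Delta(V + S) / (H(|U| + y) H(|V| + y))].  As [U] and
    [V] partition all the segments off the gap, the sum is
    [Delta(U) Delta(V)] times a sum that does not depend on the ferns but only on
    the lengths on the two sides of the gap.  That sum is evaluated on a hexagon
    without ferns, by moving the axis up to the northern side of the hexagon,
    where the sum has only one term.  The factors [s] are [Delta(U) / H(|U|)] and
    [Delta(V) / H(|V|)]. *)

(** * Perfect matchings *)

Section PerfectMatchings.

Context {V : finType} (e : rel V).
Implicit Types (A : {set V}) (T : {set {set V}}).

Definition edge_set (L : {set V}) : bool :=
  [exists u, exists v, e u v && (L == [set u; v])].

Definition matching A T : bool :=
  partition T A && [forall L in T, edge_set L].

Definition matchings A : nat := #|[set T | matching A T]|.

Lemma matchings0 : matchings set0 = 1.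
Proof.
rewrite /matchings -(cards1 (set0 : {set {set V}})); apply: eq_card => T.
rewrite !inE /matching partition_set0; apply/andP/eqP => [[/eqP] // | ->].
by split=> //; apply/forall_inP => L; rewrite inE.
Qed.

Hypotheses (esym : symmetric e) (eirr : irreflexive e).

Lemma edge_setP (T : {set {set V}}) A v :
  matching A T -> v \in A ->
  exists2 u, u \in A & e v u && ([set v; u] \in T).
Proof.
case/andP=> partT /forall_inP edgeT vA.
have covT := cover_partition partT.
have BT : pblock T v \in T by rewrite pblock_mem ?covT.
have vB : v \in pblock T v by rewrite mem_pblock covT.
have sBA : pblock T v \subset A by apply: partitionS BT.
have /existsP[p /existsP[q /andP[epq /eqP defB]]] := edgeT _ BT.
move: vB; rewrite defB !inE => /orP[] /eqP defv; rewrite defB in BT sBA.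
  exists q; first by apply: (subsetP sBA); rewrite !inE eqxx orbT.
  by rewrite defv epq.
exists p; first by apply: (subsetP sBA); rewrite !inE eqxx.
by rewrite defv esym epq setUC.
Qed.

(** Deleting the block [L] is a bijection onto the matchings of the rest: adding [L] back is
    possible because no such matching has a block through [v]. *)
Lemma matchings_through A v u :
    v \in A -> u \in A -> e v u ->
  #|[set T | matching A T && ([set v; u] \in T)]| = matchings (A :\ v :\ u).
Proof.
move=> vA uA evu; set L := [set v; u].
have defA : A = L :|: (A :\ v :\ u).
  apply/setP=> w; rewrite !inE.
  by have [->|_] /= := eqVneq w v; rewrite ?vA //; have [->|] := eqVneq w u.
have dis : [disjoint L & A :\ v :\ u].
  rewrite -setI_eq0; apply/eqP/setP => w; rewrite !inE.
  by have [] := eqVneq w v; have [] := eqVneq w u.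
have defA' : A :\: L = A :\ v :\ u.
  by apply/setP=> w; rewrite !inE negb_or -andbA andbCA.
have L0 : L != set0 by apply/set0Pn; exists v; rewrite !inE eqxx.
have LN T : partition T (A :\ v :\ u) -> L \notin T.
  move=> pT; apply/negP => LT; have /subsetP/(_ v) := partitionS pT LT.
  by rewrite !inE eqxx /= andbF => /(_ isT).
rewrite /matchings -(@card_in_imset _ _ (fun T => T :\ L)); last first.
  move=> T1 T2; rewrite !inE => /andP[_ L1] /andP[_ L2] E.
  by rewrite -(setD1K L1) -(setD1K L2) E.
apply: eq_card => T; apply/imsetP/idP => [[T1] |].
  rewrite !inE => /andP[/andP[p1 /forall_inP e1] L1] ->.
  rewrite /matching -defA' partitionD1 //=.
  by apply/forall_inP => B; rewrite inE => /andP[_ /e1].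
rewrite inE => /andP[pT /forall_inP eT]; exists (L |: T); last first.
  by rewrite setU1K // LN.
rewrite !inE eqxx andbT /matching {1}defA partitionU1 //=.
apply/forall_inP => B; rewrite !inE => /predU1P[->|/eT //].
by apply/existsP; exists v; apply/existsP; exists u; rewrite evu eqxx.
Qed.

Lemma matchings_expand A v : v \in A ->
  matchings A = \sum_(u in A | e v u) matchings (A :\ v :\ u).
Proof.
move=> vA; rewrite {1}/matchings -sum1_card.
(* Each matching is counted once, through the partner of [v]: blocks of a partition that both
   contain [v] coincide. *)
transitivity (\sum_(T in [set T | matching A T])
                \sum_(u in A | e v u && ([set v; u] \in T)) 1).
  apply: eq_bigr => T; rewrite inE => mT.
  have [u uA /andP[evu uT]] := edge_setP mT vA.
  rewrite (big_pred1 u) // => w; apply/andP/eqP => [[wA /andP[evw wT]]|-> /[!evu]//].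
  have trivT := partition_trivIset (andP mT).1.
  have := def_pblock trivT wT (set21 v w).
  rewrite (def_pblock trivT uT (set21 v u)) => E.
  have := set22 v w; rewrite -E !inE => /orP[] /eqP // Ewv.
  by rewrite Ewv eirr in evw.
rewrite (exchange_big_dep (fun u => (u \in A) && e v u)) /=; last first.
  by move=> T u _ /and3P[-> ->].
apply: eq_bigr => u /andP[uA evu]; rewrite -matchings_through // -sum1_card.
by apply: eq_bigl => T; rewrite !inE uA evu.
Qed.

End PerfectMatchings.

Lemma imset_setD1 (V1 V2 : finType) (h : V1 -> V2) (A : {set V1}) v :
  injective h -> h @: (A :\ v) = h @: A :\ h v.
Proof.
move=> hinj; apply/setP=> y; rewrite inE in_set1.
apply/imsetP/andP => [[x] | [yv /imsetP[x xA Ey]]].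
  rewrite !inE => /andP[xv xA] ->; rewrite imset_f //; split=> //.
  by rewrite (inj_eq hinj).
by exists x; rewrite // !inE xA andbT; apply: contraNneq yv => <-; rewrite Ey.
Qed.

(** Instead of transporting partitions along [h], both counts are expanded at corresponding vertices
    and compared by induction on the size of [A]. *)
Lemma matchings_transfer (V1 V2 : finType) (e1 : rel V1) (e2 : rel V2)
    (h : V1 -> V2) (A : {set V1}) :
  symmetric e1 -> irreflexive e1 -> symmetric e2 -> irreflexive e2 ->
  injective h -> {mono h : u v / e1 u v >-> e2 u v} ->
  matchings e2 (h @: A) = matchings e1 A.
Proof.
move=> s1 i1 s2 i2 hinj he; have [k] := ubnP #|A|.
elim: k A => // k IHk A leAk; have [->|[v vA]] := set_0Vmem A.
  by rewrite imset0 !matchings0.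
rewrite (matchings_expand s1 i1 vA) (matchings_expand s2 i2 (imset_f h vA)).
rewrite (big_imset_cond _ _ _ (in2W hinj)) /=.
apply: eq_big => [u|u /andP[uA evu]]; first by rewrite he.
rewrite -IHk; last first.
  rewrite (cardsD1 v) vA in leAk; apply: leq_ltn_trans (_ : #|A :\ v| < k) => //.
  by rewrite subset_leq_card // subsetDl.
by rewrite !imset_setD1.
Qed.

(** * Lozenge tilings as perfect matchings *)

Lemma share_edgeE (i j k l : int) (p q : bool) :
  share_edge ((i, j), p) ((k, l), q) =
  match p, q with
  | true, false => (k == i) && ((l == j) || (l == j - 1)) || (k == i - 1) && (l == j)
  | false, true => (i == k) && ((j == l) || (j == l - 1)) || (i == k - 1) && (j == l)
  | _, _ => false
  end%R.
Proof.
(* Only the offsets -1, 0 and 1 matter in either coordinate; triangles farther apart share no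
   vertex. *)
have hk : [|| k == i, k == i - 1, k == i + 1 | (k < i - 1) || (i + 1 < k)]%R by lia.
have hl : [|| l == j, l == j - 1, l == j + 1 | (l < j - 1) || (j + 1 < l)]%R by lia.
have F (a b : int) : (a < b)%R || (b < a)%R -> (a == b) = false by lia.
have A (a : int) : (a + 1 - 1 = a)%R by lia.
have B (a : int) : (a - 1 + 1 = a)%R by lia.
have C (a : int) : (a == a + 1)%R = false by lia.
have C' (a : int) : (a + 1 == a)%R = false by lia.
have D (a : int) : (a == a + 1 + 1)%R = false by lia.
have D' (a : int) : (a + 1 + 1 == a)%R = false by lia.
have G (a : int) : (a == a - 1)%R = false by lia.
have G' (a : int) : (a - 1 == a)%R = false by lia.
have I (a : int) : (a - 1 == a + 1)%R = false by lia.
have I' (a : int) : (a + 1 == a - 1)%R = false by lia.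
have J (a b : int) : (a + 1 == b + 1)%R = (a == b) by lia.
have E := (A, B, C, C', D, D', G, G', I, I', J, eqxx).
rewrite /share_edge xpair_eqE.
case: p q => [] [] /=; rewrite !inE !xpair_eqE ?andbT ?andbF.
all: case/or4P: hk => [/eqP->|/eqP->|/eqP->|hk].
all: case/or4P: hl => [/eqP->|/eqP->|/eqP->|hl].
all: rewrite ?E ?andbF ?orbF //=.
all: rewrite ?F ?andbF ?orbF //; lia.
Qed.

Lemma share_edgeC : symmetric share_edge.
Proof.
by case=> [[i j] []] [[k l] []]; rewrite !share_edgeE.
Qed.

Lemma share_edge_irr : irreflexive share_edge.
Proof. by move=> u; rewrite /share_edge eqxx. Qed.

Local Notation shareR R := (fun u v : R => share_edge (val u) (val v)).

(** The vertex type in [M] changes with the region. Viewing all subregions inside one [R] lets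
    triangles be removed without changing the type. *)
Lemma M_matchings (R R' : {fset triangle}) : (R' `<=` R)%fset ->
  M R' = matchings (shareR R) [set u | val u \in R'].
Proof.
move=> sRR.
transitivity (matchings (shareR R') [set: R']); first by [].
rewrite -(@matchings_transfer _ _ _ (shareR R) (fincl sRR)).
- congr matchings; apply/setP=> u; rewrite inE; apply/imsetP/idP.
    by case=> v _ ->; apply: fsvalP.
  by move=> uR; exists [` uR]%fset => //; apply: val_inj.
- by move=> u v; apply: share_edgeC.
- by move=> u; apply: share_edge_irr.
- by move=> u v; apply: share_edgeC.
- by move=> u; apply: share_edge_irr.
- by move=> u v /(congr1 val) /= E; apply: val_inj.
- by [].
Qed.

Lemma M_expand (R : {fset triangle}) v : v \in R ->
  M R = \sum_(u <- R | share_edge v u) M (R `\ v `\ u)%fset.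
Proof.
move=> vR; rewrite (M_matchings (fsubset_refl R)).
rewrite (@matchings_expand _ _ _ _ _ [` vR]%fset) ?inE //.
- rewrite big_seq_fsetE /=; apply: eq_big => [u|u _]; first by rewrite inE fsvalP.
  rewrite (@M_matchings R) ?fsubDset; last first.
    by rewrite fsetUA fsubsetU // fsubset_refl orbT.
  congr matchings; apply/setP=> w.
  by rewrite !inE -!val_eqE.
- by move=> p q; apply: share_edgeC.
- by move=> p; apply: share_edge_irr.
Qed.

Lemma M0 : M fset0 = 1.
Proof.
rewrite (M_matchings (fsubset_refl _)) -[RHS](matchings0 (shareR fset0)).
by congr matchings; apply/setP=> -[u uP]; rewrite !inE.
Qed.

Lemma triangle_fsetP (A B : {fset triangle}) :
  (forall (i j : int) p, (((i, j), p) \in A) = (((i, j), p) \in B)) -> A = B.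
Proof. by move=> AB; apply/fsetP=> -[[i j] p]. Qed.

Lemma M_expand_seq (R : {fset triangle}) v (N : seq triangle) :
    v \in R -> uniq N ->
    (forall u : triangle, (u \in N) = (u \in R) && share_edge v u) ->
  M R = \sum_(u <- N) M (R `\ v `\ u)%fset.
Proof.
move=> vR uN memN; rewrite (M_expand vR) -big_filter; apply: perm_big.
apply: uniq_perm => // [|u]; first by rewrite filter_uniq.
by rewrite mem_filter memN andbC.
Qed.

Lemma M_forced (R : {fset triangle}) v u :
    v \in R -> u \in R -> share_edge v u ->
    (forall w : triangle, w \in R -> share_edge v w -> w = u) ->
  M R = M (R `\ v `\ u)%fset.
Proof.
move=> vR uR vu unique; rewrite (M_expand_seq (N := [:: u]) vR) ?big_seq1 //.
move=> w; rewrite inE; apply/eqP/andP => [-> // | [wR vw]]; exact: unique.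
Qed.

Lemma M_isolated (R : {fset triangle}) v :
  v \in R -> (forall w : triangle, w \in R -> ~~ share_edge v w) -> M R = 0.
Proof.
move=> vR iso; rewrite (M_expand_seq (N := [::]) vR) ?big_nil // => w.
by rewrite in_nil; apply/esym/negbTE/negP => /andP[/iso/negP].
Qed.

Lemma M_imfset (h : triangle -> triangle) (R : {fset triangle}) :
  injective h -> {mono h : u v / share_edge u v} ->
  M [fset h u | u in R]%fset = M R.
Proof.
move=> hinj hshare; set hR := [fset h u | u in R]%fset.
have hP (u : R) : h (val u) \in hR by apply: in_imfset; apply: fsvalP.
rewrite (M_matchings (fsubset_refl R)) (M_matchings (fsubset_refl hR)).
rewrite -(@matchings_transfer _ _ _ (fun u v : hR => share_edge (val u) (val v))
           (fun u => [` hP u]%fset)).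
- congr matchings; apply/setP=> u; rewrite inE fsvalP; apply/esym/imsetP.
  have /imfsetP[v /= vR Eu] := fsvalP u.
  by exists [` vR]%fset; rewrite ?inE //; apply: val_inj.
- by move=> u v; apply: share_edgeC.
- by move=> u; apply: share_edge_irr.
- by move=> u v; apply: share_edgeC.
- by move=> u; apply: share_edge_irr.
- by move=> u v /(congr1 val) /= /hinj E; apply: val_inj.
- by move=> u v; rewrite /= hshare.
Qed.

(** * Tilings of a region cut into two pieces *)

Section Split.

Context {I : finType} {u v : I -> triangle}.
Hypotheses (u_inj : injective u) (v_inj : injective v).
Hypothesis uv : forall i, share_edge (u i) (v i).

Local Notation crossing R1 R2 S :=
  [forall i in S, (u i \in R1) && (v i \in R2)]%fset.

(** Tilings are sorted by the set [S] of pairs [u i], [v i] that they use as lozenges; no other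
    lozenge can straddle the cut. The proof is by induction on [R1], expanding at one of its
    triangles [w]. *)
Lemma M_split (R1 R2 : {fset triangle}) : [disjoint R1 & R2]%fset ->
    (forall p q : triangle, p \in R1 -> q \in R2 -> share_edge p q ->
       exists i, p = u i /\ q = v i) ->
  M (R1 `|` R2)%fset = \sum_(S : {set I} | crossing R1 R2 S)
    M (R1 `\` [fset u i | i in S])%fset * M (R2 `\` [fset v i | i in S])%fset.
Proof.
have [k] := ubnP #|` R1|; elim: k R1 R2 => // k IHk R1 R2 leRk dis cross.
have [R10|[w wR1]] := fset_0Vmem R1.
  have im0 (f : I -> triangle) : [fset f i | i in set0]%fset = fset0.
    by apply/fsetP=> q; rewrite inE; apply/imfsetP => -[i]; rewrite inE.
  rewrite R10 fset0U (big_pred1 set0) => [|S /=]; first by rewrite !im0 !fsetD0 M0 mul1n.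
  apply/forall_inP/eqP => [noS|->]; last by move=> i; rewrite inE.
  by apply/setP=> i; rewrite inE; apply/negP => /noS.
have disP p : p \in R1 -> p \in R2 -> False.
  by move=> p1 p2; move/fdisjointP: dis => /(_ p p1) /negP.
rewrite (M_expand_seq (v := w) (N := [seq q <- R1 | share_edge w q] ++
                           [seq q <- R2 | share_edge w q])); first 1 last.
- by rewrite inE wR1.
- rewrite cat_uniq !filter_uniq ?fset_uniq //= andbT; apply/hasPn => q.
  by rewrite !mem_filter => /andP[_ q2]; apply/negP=> /andP[_ /disP]; apply.
- by move=> q; rewrite mem_cat !mem_filter inE andb_orl !(andbC (share_edge _ _)).
have lek X : (#|` R1 `\ w `\` X|%fset < k)%N.
  apply: leq_ltn_trans (fsubset_leq_card (fsubsetDl _ _)) _.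
  by rewrite (cardfsD1 w) wR1 in leRk.
rewrite big_cat !big_filter /=.
(* Sets whose crossings avoid [w] account for the partners of [w] in [R1], the other sets for a
   partner in [R2]. *)
rewrite (bigID (fun S : {set I} => w \notin [fset u i | i in S]%fset)) /=.
congr (_ + _).
  transitivity (\sum_(q <- R1 | share_edge w q)
     \sum_(S : {set I} | crossing R1 R2 S &&
         ((w \notin [fset u i | i in S]%fset) && (q \notin [fset u i | i in S]%fset)))
       M (R1 `\` [fset u i | i in S] `\ w `\ q)%fset *
       M (R2 `\` [fset v i | i in S])%fset).
    rewrite big_seq_cond [RHS]big_seq_cond; apply: eq_bigr => q /andP[q1 wq].
    have -> : ((R1 `|` R2) `\ w `\ q = (R1 `\ w `\ q) `|` R2)%fset.
      apply/fsetP=> p; rewrite !inE; have [->|_] := eqVneq p q.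
        by apply/esym/negP => /disP; apply.
      have [->|//] := eqVneq p w; by apply/esym/negP => /disP; apply.
    rewrite IHk //.
    - apply: eq_big => S.
        apply/forall_inP/and3P => [okS | [/forall_inP okS wS qS] i iS].
          split.
          - by apply/forall_inP=> i /okS; rewrite !inE => /andP[/and3P[_ _ ->] ->].
          - by apply/imfsetP => -[i /= /okS + Ew]; rewrite -Ew !inE eqxx /= andbF.
          - by apply/imfsetP => -[i /= /okS + Eq]; rewrite -Eq !inE eqxx /=.
        rewrite !inE; have /andP[-> ->] := okS i iS; rewrite !andbT.
        apply/andP; split; [apply: contraNneq qS | apply: contraNneq wS] => <-;
          exact: in_imfset.
      by move=> _; congr (M _ * _); apply/fsetP=> p; rewrite !inE; do !case: (_ \in _); do !case: (_ == _).
    - by apply/fdisjointP=> p; rewrite !inE => /and3P[_ _ /disP p2]; apply/negP.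
    - by move=> p p'; rewrite !inE => /and3P[_ _]; apply: cross.
  rewrite (exchange_big_dep (fun S : {set I} => crossing R1 R2 S && (w \notin [fset u i | i in S]%fset))) /=; last first.
    by move=> q S _ /and3P[-> ->].
  apply: eq_bigr => S /andP[okS wS].
  (* For fixed [S] the sum over [q] is the expansion at [w] of [R1] without its crossing
     triangles. *)
  rewrite (@M_expand (R1 `\` _)%fset w) ?inE ?wS // big_distrl /=.
  rewrite -big_filter -[RHS]big_filter; apply: perm_big.
  apply: uniq_perm; rewrite ?filter_uniq ?fset_uniq // => q.
  by rewrite !mem_filter !inE okS -andbA.
(* A partner across the cut exists only if [w] is some [u i0], and it is then [v i0] by injectivity
   of [u]. *)
have [/existsP[i0 /andP[/eqP Ew v0]]|noi] :=
    boolP [exists i, (w == u i) && (v i \in R2)]; last first.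
  rewrite big_seq_cond big_pred0 => [|q]; last first.
    apply/negP => /andP[q2 wq]; have [i [Ew Eq]] := cross _ _ wR1 q2 wq.
    by move/existsP: noi; case; exists i; rewrite Ew eqxx -Eq.
  rewrite big_pred0 // => S; apply/negP => /andP[/forall_inP okS].
  rewrite negbK => /imfsetP[i /= iS Ew]; move/existsP: noi; case.
  by exists i; rewrite Ew eqxx; case/andP: (okS i iS).
transitivity (\sum_(q <- [:: v i0]) M ((R1 `|` R2) `\ w `\ q)%fset).
  rewrite -big_filter; apply: perm_big; apply: uniq_perm => // [|q].
    by rewrite filter_uniq ?fset_uniq.
  rewrite mem_filter inE; apply/andP/eqP => [[wq q2]|->]; last by rewrite Ew uv.
  have [i [Ew' ->]] := cross _ _ wR1 q2 wq.
  by congr v; apply: u_inj; rewrite -Ew'.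
rewrite big_seq1.
have -> : ((R1 `|` R2) `\ w `\ v i0 = (R1 `\ w) `|` (R2 `\ v i0))%fset.
  apply/fsetP=> p; rewrite !inE; have [->|_] /= := eqVneq p (v i0).
    by rewrite orbF; apply/esym/negP=> /andP[_ /disP]; apply.
  by have [->|//] := eqVneq p w; apply/esym/negP => /disP; apply.
rewrite IHk.
- rewrite [RHS](reindex_onto (fun S => i0 |: S) (fun S => S :\ i0)) /=; last first.
    move=> S /andP[_]; rewrite negbK => /imfsetP[i /= iS].
    by rewrite Ew => /u_inj Ei; rewrite setD1K // Ei.
  apply: eq_big => [S|S /forall_inP okS].
    rewrite -andbA; apply/forall_inP/and3P => [okS | [/forall_inP okS _ /eqP ES] i iS].
      have i0S : i0 \notin S by apply/negP=> /okS; rewrite !inE Ew eqxx.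
      split.
      + apply/forall_inP=> i; rewrite !inE => /predU1P[->|/okS].
          by rewrite -Ew wR1 v0.
        by rewrite !inE -andbA => /and4P[_ -> _ ->].
      + by rewrite negbK Ew in_imfset //= !inE eqxx.
      + by rewrite setU1K.
    have iN : i != i0 by apply: contraTneq iS => ->; rewrite -ES !inE eqxx.
    have /okS/andP[] : i \in i0 |: S by rewrite !inE iS orbT.
    by rewrite !inE Ew (inj_eq u_inj) (inj_eq v_inj) iN => -> ->.
  have EU (f : I -> triangle) : [fset f i | i in i0 |: S]%fset =
      (f i0 |` [fset f i | i in S])%fset.
    apply/fsetP=> p; rewrite !inE; apply/imfsetP/predU1P => [[i /=]|[->|]].
    + by rewrite !inE => /predU1P[->|iS] ->; [left | right; apply: in_imfset].
    + by exists i0; rewrite //= !inE eqxx.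
    + by case/imfsetP=> i /= iS ->; exists i; rewrite //= !inE iS orbT.
  by rewrite !EU -Ew !fsetDDl.
- by have := lek fset0; rewrite fsetD0.
- apply/fdisjointP=> p; rewrite !inE => /andP[_ p1]; apply/negP=> /andP[_].
  by apply/negP; apply/negP => /(disP p p1).
- by move=> p q; rewrite !inE => /andP[_ p1] /andP[_ q2]; apply: cross.
Qed.

End Split.

(** * Balance between the two orientations *)

Definition ups (R : {fset triangle}) : nat := count (fun u => u.2) R.
Definition downs (R : {fset triangle}) : nat := count (fun u => ~~ u.2) R.

Lemma count_fsetD1 (p : pred triangle) (R : {fset triangle}) u :
  u \in R -> count p R = p u + count p (R `\ u)%fset.
Proof.
move=> uR; rewrite -!sumn_count /= -[_ + _]/(sumn [seq p v : nat | v <- u :: (R `\ u)%fset]).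
apply/perm_sumn/perm_map/uniq_perm; rewrite //= ?inE ?eqxx ?fset_uniq //.
by move=> v; rewrite !inE; case: eqVneq => [->|].
Qed.

(** Every lozenge joins an up-pointing to a down-pointing triangle, so removing a lozenge preserves
    the difference of the two counts. This later fixes the number of crossings of the axis. *)
Lemma M_balanced (R : {fset triangle}) : M R != 0 -> ups R = downs R.
Proof.
have [k] := ubnP #|` R|; elim: k R => // k IHk R leRk.
have [->|[v vR]] := fset_0Vmem R; first by rewrite /ups /downs /= .
rewrite (M_expand vR) sum_nat_seq_neq0 => /hasP[u uR /andP[vu]].
have uR' : u \in (R `\ v)%fset.
  by rewrite !inE uR andbT; apply: contraTneq vu => ->; rewrite share_edge_irr.
move/IHk => IH; rewrite /ups /downs.
do 2![rewrite [count _ R](count_fsetD1 _ vR) [count _ (R `\ v)%fset](count_fsetD1 _ uR')].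
move: IH; rewrite /ups /downs.
have -> : u.2 = ~~ v.2.
  by move: u v vu {uR vR uR'} => [[i j] []] [[k' l] []]; rewrite share_edgeE.
move=> -> ; first by case: (v.2).
apply: leq_ltn_trans (fsubset_leq_card (fsubsetDl _ _)) _.
by rewrite (cardfsD1 v) vR in leRk.
Qed.

(** * Rows of a trapezoid *)

Local Open Scope ring_scope.

Local Notation up i j := ((i, j), true).
Local Notation dn i j := ((i, j), false).

(* [in_cons] at type [int] itself, so that [lia] identifies the membership atoms. *)
Lemma in_consz (i k : int) (s : seq int) : (i \in k :: s) = (i == k) || (i \in s).
Proof. exact: in_cons. Qed.

Definition irange (p : int) (k : nat) : seq int := [seq p + i%:Z | i <- iota 0 k].

Lemma mem_irange p k i : (i \in irange p k) = (p <= i < p + k%:Z).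
Proof.
apply/mapP/idP => [[l] | ip]; first by rewrite mem_iota => ? ->; lia.
by exists `|i - p|%N; rewrite ?mem_iota; lia.
Qed.

Lemma irange_uniq p k : uniq (irange p k).
Proof. by rewrite map_inj_uniq ?iota_uniq // => i l; lia. Qed.

Lemma size_irange p k : size (irange p k) = k.
Proof. by rewrite size_map size_iota. Qed.

Lemma irangeS p k : irange p k.+1 = p :: irange (p + 1) k.
Proof.
rewrite /irange /= addr0 (iotaDl 1 0) -map_comp; congr (_ :: _).
by apply: eq_map => i /=; lia.
Qed.

HB.lock Definition dns (X : seq int) (j : int) : {fset triangle} :=
  [fset u in [seq dn i j | i <- X]]%fset.

Lemma in_dns X j (i l : int) p :
  (((i, l), p) \in dns X j) = [&& ~~ p, l == j & i \in X].
Proof.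
rewrite unlock inE /=; apply/mapP/and3P => [[k kX [-> -> ->]] // | [pF /eqP-> iX]].
by exists i; rewrite // (negbTE pF).
Qed.

(** One lattice row with dents [D] in its top side. For [l = c + 1] and [m = k - 1] it is a
    trapezoid with the longer side on top; for [l = c] and [m = k] it is a parallelogram that starts
    with an up-pointing triangle. *)
HB.lock Definition strip (c : int) (k : nat) (l : int) (m : nat) (j : int) (D : seq int) :
    {fset triangle} :=
  [fset u in [seq dn i j | i <- irange c k & i \notin D] ++
             [seq up i j | i <- irange l m]]%fset.

Lemma in_strip c k l m j D (i h : int) p :
  (((i, h), p) \in strip c k l m j D) =
  (h == j) && (if p then l <= i < l + m%:Z
               else (c <= i < c + k%:Z) && (i \notin D)).
Proof.
rewrite unlock in_fset -[in_mem _ _]/(_ \in _ ++ _) mem_cat; apply/orP/andP => [|[/eqP->]].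
  case=> /mapP[q]; first by rewrite mem_filter mem_irange => /andP[qD qc] [-> -> ->]; rewrite qD qc.
  by rewrite mem_irange => ql [-> -> ->].
case: p => iP; [right | left]; apply/mapP; exists i => //.
  by rewrite mem_irange.
by rewrite mem_filter andbC mem_irange.
Qed.

(* Sum over the sequences [x_1, ..., x_k] interlacing with [D = d_1, ..., d_k]:
   [l <= x_1 <= d_1 < x_2 <= d_2 < ... <= d_k]. *)
Fixpoint sum_below (l : int) (D : seq int) (F : seq int -> rat) : rat :=
  if D is d :: D' then
    \sum_(x <- irange l (absz (d + 1 - l)%R)) sum_below (d + 1) D' (fun X => F (x :: X))
  else F [::].

(** The first entry of [D] only bounds [x_1] strictly from below, so the sequences have one entry
    fewer than [D]. The value 0 at the empty list is the right count: an undented row has one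
    down-pointing triangle too many, and nothing above to pair it with. *)
Definition sum_interlacing (D : seq int) (F : seq int -> rat) : rat :=
  if D is d :: D' then sum_below (d + 1) D' F else 0.

Lemma eq_sum_below l D F G : F =1 G -> sum_below l D F = sum_below l D G.
Proof.
elim: D l F G => [|d D IHD] l F G FG; first exact: FG.
by apply: eq_bigr => x _; apply: IHD => X; apply: FG.
Qed.

Lemma eq_sum_interlacing D F G :
  F =1 G -> sum_interlacing D F = sum_interlacing D G.
Proof. by case: D => //= d D; apply: eq_sum_below. Qed.

(** Separating the least value of [x_1] gives the recursion followed by the leftmost up-pointing
    triangle of a row, which pairs downwards or to the right. *)
Lemma sum_below_cons l d D F : l <= d -> sum_below l (d :: D) F =
  sum_below (d + 1) D (fun X => F (l :: X)) +
  (if d == l then 0 else sum_below (l + 1) (d :: D) F).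
Proof.
move=> ld /=; have -> : absz (d + 1 - l)%R = (absz (d - l)%R).+1 by lia.
rewrite irangeS big_cons; congr (_ + _); case: eqVneq => [->|_].
  by rewrite subrr big_nil.
by congr (\sum_(x <- irange _ _) _); lia.
Qed.

Section Peel.

Variable j : int.

Definition below_row (W : {fset triangle}) (c : int) (k : nat) : Prop :=
  (forall (i h : int) p, ((i, h), p) \in W -> h < j) /\
  (forall i, c <= i < c + k%:Z -> dn i (j - 1) \in W).

Definition in_range (D : seq int) (c : int) (k : nat) : Prop :=
  sorted <%R D /\ (forall i, i \in D -> c <= i < c + k%:Z).

(** The row starts with an up-pointing triangle in [peelB] and with a down-pointing one in [peelA];
    [X] records the up-pointing triangles paired with the row beneath. Removing the leftmost
    triangles leads from one form to the other, hence a joint induction on the width. *)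
Let peelB k := forall c D W, in_range D c k -> below_row W c k ->
  (M (strip c k c k j D `|` W)%fset)%:R =
  sum_below c D (fun X => (M (W `\` dns X (j - 1))%fset)%:R).

Let peelA k := forall c D W, in_range D c k.+1 -> below_row W (c + 1) k ->
  (M (strip c k.+1 (c + 1) k j D `|` W)%fset)%:R =
  sum_interlacing D (fun X => (M (W `\` dns X (j - 1))%fset)%:R).

Lemma in_range_tail d D c k : in_range (d :: D) c k ->
  in_range D (d + 1) (absz (c + k%:Z - (d + 1))%R).
Proof.
case=> sD rD; split; first by apply: (path_sorted sD).
move=> i iD; have := rD i; have := rD d; rewrite !inE eqxx iD orbT => /(_ isT) h1 /(_ isT) h2.
have : d < i by move: sD => /= /(order_path_min lt_trans) /allP /(_ i iD).
lia.
Qed.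

Lemma in_range_head D c k : in_range D c k.+1 ->
  (exists2 D', D = c :: D' & in_range D' (c + 1) k) \/
  (c \notin D /\ in_range D (c + 1) k).
Proof.
case: D => [|d D] rD; first by right; split=> //; split.
have [Ed|dc] := eqVneq d c; [left | right].
  exists D; first by rewrite Ed.
  have := in_range_tail rD; rewrite Ed; congr (in_range _ _ _); lia.
have cd : c < d by have := rD.2 d (mem_head _ _); lia.
have lt i : i \in d :: D -> c < i.
  rewrite inE => /predU1P[->//|iD]; apply: lt_trans cd _.
  by move: rD.1 => /= /(order_path_min lt_trans) /allP /(_ i iD).
split; first by apply/negP=> /lt; rewrite ltxx.
by split; [exact: rD.1 | move=> i iD; have := rD.2 i iD; have := lt i iD; lia].
Qed.

(** The leftmost triangle [dn c j] is a dent, which leaves the form [peelB], or it must pair with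
    [up (c + 1) j], which leaves a narrower row of the form [peelA]. *)
Lemma peel_step_A k : peelB k -> (if k is k'.+1 then peelA k' else True) -> peelA k.
Proof.
move=> IHB IHA c D W rD [Wj Wd].
have [[D' -> rD']|[cD rD']] := in_range_head rD.
  rewrite /= -IHB //; congr (M (_ `|` _)%fset)%:R; apply: triangle_fsetP => i h p.
  by rewrite !in_strip in_consz; case: p => //; lia.
(* In width 1 without a dent, [dn c j] has no neighbour, in accordance with the value 0 at the empty
   list. *)
case: k IHB IHA rD Wd rD' => [|k] IHB IHA rD Wd rD'.
  have -> : D = [::].
    case: D rD' {IHB IHA rD cD} => // d D [_ /(_ d)]; rewrite inE eqxx => /(_ isT); lia.
  rewrite (@M_isolated _ (dn c j)) // ?in_fsetU ?in_strip ?eqxx /=; first lia.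
  move=> [[i h] []]; rewrite in_fsetU in_strip share_edgeE // => /orP[|/Wj]; lia.
rewrite (@M_forced _ (dn c j) (up (c + 1) j)); first 1 last.
- by rewrite !in_fsetU !in_strip eqxx cD /=; lia.
- by rewrite !in_fsetU !in_strip eqxx /=; lia.
- by rewrite share_edgeE; lia.
- move=> [[i h] []]; rewrite in_fsetU in_strip share_edgeE // => /orP[|/Wj] hh ee.
    by congr (up _ _); lia.
  lia.
rewrite -(IHA (c + 1)) //; last by split=> // i ic; apply: Wd; lia.
congr (M _)%:R; apply: triangle_fsetP => i h p.
rewrite !in_fsetD1 !in_fsetU !in_strip !xpair_eqE; case: p => /=; rewrite ?andbF ?andbT /=.
  case WP: (_ \in W); [have := Wj _ _ _ WP|]; lia.
case WP: (_ \in W); [have := Wj _ _ _ WP|]; lia.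
Qed.

Lemma dns_cons_setD W c X :
  (W `\ dn c (j - 1) `\` dns X (j - 1) = W `\` dns (c :: X) (j - 1))%fset.
Proof.
apply: triangle_fsetP => i h p; rewrite !in_fsetD in_fset1 !in_dns in_consz !xpair_eqE.
by case: p => /=; rewrite ?andbF //; lia.
Qed.

(** The leftmost triangle [up c j] pairs with [dn c (j - 1)], so that [X] starts with [c], or with
    [dn c j] if this is not a dent: these are the two terms of [sum_below_cons]. *)
Lemma peel_step_B k : peelB k -> peelA k -> peelB k.+1.
Proof.
move=> IHB IHA c D W rD [Wj Wd].
have W' : below_row W (c + 1) k by split=> // i ic; apply: Wd; lia.
have Wc : dn c (j - 1) \in W by apply: Wd; lia.
set F := fun X => (M (W `\` dns X (j - 1))%fset)%:R.
have downE : (M ((strip c k.+1 c k.+1 j D `|` W) `\ up c j `\ dn c (j - 1))%fset)%:R =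
    sum_interlacing D (fun X => F (c :: X)).
  have -> : ((strip c k.+1 c k.+1 j D `|` W) `\ up c j `\ dn c (j - 1) =
             strip c k.+1 (c + 1) k j D `|` (W `\ dn c (j - 1)))%fset.
    apply: triangle_fsetP => i h p.
    rewrite !(in_fsetD1, in_fsetU) !in_strip !xpair_eqE; case: p => /=.
      by case WP: (_ \in W); [have := Wj _ _ _ WP|]; lia.
    by case WP: (_ \in W); [have := Wj _ _ _ WP|]; lia.
  rewrite IHA //.
    by apply: eq_sum_interlacing => X; rewrite /F dns_cons_setD.
  split=> [i h p|i ic]; rewrite in_fsetD1; first by case/andP=> _ /Wj.
  by rewrite W'.2 // !xpair_eqE; lia.
have nb (w : triangle) : w \in (strip c k.+1 c k.+1 j D `|` W)%fset ->
    share_edge (up c j) w -> w = dn c (j - 1) \/ c \notin D /\ w = dn c j.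
  case: w => [[i h] []]; rewrite in_fsetU in_strip share_edgeE // => inW adj.
  have [/andP[/eqP-> /eqP->]|ne] := boolP ((i == c) && (h == j - 1)); first by left.
  have ehj : h = j by lia.
  have ic : i = c.
    case/orP: inW => [|/Wj]; lia.
  right; subst i h; split=> //; case/orP: inW => [|/Wj]; first by lia.
  by rewrite ltxx.
have upR : up c j \in (strip c k.+1 c k.+1 j D `|` W)%fset.
  by rewrite in_fsetU in_strip eqxx /=; lia.
have dnR : dn c (j - 1) \in (strip c k.+1 c k.+1 j D `|` W)%fset.
  by rewrite in_fsetU Wc orbT.
have adjd : share_edge (up c j) (dn c (j - 1)) by rewrite share_edgeE; lia.
(* A dent at [c] blocks the horizontal lozenge; correspondingly the interval of [x_1] reduces to
   [c]. *)
have [[D' ED rD']|[cD rD']] := in_range_head rD.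
  rewrite (M_forced upR dnR adjd) => [|w wR cw]; last first.
    by have [//|[/negP[]]] := nb _ wR cw; rewrite ED inE eqxx.
  rewrite downE ED sum_below_cons // eqxx addr0 /=.
  by apply: eq_sum_below => X.
rewrite (@M_expand_seq _ (up c j) [:: dn c (j - 1); dn c j]) //; first 1 last.
- by rewrite /= inE !xpair_eqE; lia.
- move=> w; apply/idP/andP => [|[wR cw]].
    rewrite in_cons mem_seq1 => /orP[] /eqP->; first by rewrite dnR.
    rewrite in_fsetU in_strip eqxx cD share_edgeE; lia.
  by rewrite in_cons mem_seq1; have [->|[_ ->]] := nb _ wR cw; apply/orP; [left|right].
rewrite big_cons big_seq1 natrD [X in X + _ = _]downE.
have -> : ((strip c k.+1 c k.+1 j D `|` W) `\ up c j `\ dn c j =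
           strip (c + 1) k (c + 1) k j D `|` W)%fset.
  apply: triangle_fsetP => i h p.
  rewrite !(in_fsetD1, in_fsetU) !in_strip !xpair_eqE; case: p => /=.
    by case WP: (_ \in W); [have := Wj _ _ _ WP|]; lia.
  by case WP: (_ \in W); [have := Wj _ _ _ WP|]; lia.
rewrite IHB //; case: D rD cD rD' {downE nb upR dnR} => [|d D] rD cD rD'.
  by rewrite /= add0r.
have cd : c < d by have := rD'.2 d (mem_head _ _); lia.
rewrite (sum_below_cons _ _ (ltW cd)); congr (_ + _).
by case: eqVneq => // E; rewrite E ltxx in cd.
Qed.

Lemma peel_row k c D W : in_range D c k.+1 -> below_row W (c + 1) k ->
  (M (strip c k.+1 (c + 1) k j D `|` W)%fset)%:R =
  sum_interlacing D (fun X => (M (W `\` dns X (j - 1))%fset)%:R).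
Proof.
suff [_ pA] : peelB k /\ peelA k by exact: pA.
clear c D W.
elim: k => [|k [IHB IHA]].
  have B0 : peelB 0.
    move=> c' D' W' rD' _; have -> : D' = [::].
      case: D' rD' => // d D' [_ /(_ d)]; rewrite inE eqxx => /(_ isT); lia.
    congr (M _)%:R; apply: triangle_fsetP => i h p.
    by rewrite in_fsetU in_strip [RHS]in_fsetD in_dns !in_nil; case: p => /=; rewrite ?andbF; lia.
  by split=> //; apply: peel_step_A.
have B1 := peel_step_B IHB IHA; split=> //; exact: peel_step_A.
Qed.

End Peel.

(** * Telescoping determinants *)

(** The matrix is a Vandermonde matrix times the matrix of coefficients, which is triangular with
    ones on the diagonal. *)
Lemma det_monic_basis (F : fieldType) k (p : nat -> {poly F}) (a : 'rV[F]_k) :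
    (forall j, p j \is monic) -> (forall j, size (p j) = j.+1) ->
  \det (\matrix_(i < k, j < k) (p j).[a 0 i]) =
  \prod_(i < k) \prod_(j < k | (i < j)%N) (a 0 j - a 0 i).
Proof.
move=> monic_p size_p; pose C : 'M[F]_k := \matrix_(l, j) (p j)`_l.
have -> : \matrix_(i < k, j < k) (p j).[a 0 i] = (Vandermonde k a)^T *m C.
  apply/matrixP => i j; rewrite !mxE (@horner_coef_wide _ k); last by rewrite size_p.
  by apply: eq_bigr => l _; rewrite !mxE mulrC.
rewrite det_mulmx det_tr det_Vandermonde -(det_tr C) det_trig.
  rewrite [X in _ * X]big1 ?mulr1 // => i _; rewrite !mxE.
  by have /monicP := monic_p i; rewrite lead_coefE size_p.
apply/is_trig_mxP => i j ij; rewrite !mxE nth_default // size_p; exact: ij.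
Qed.

(** The unitriangular [L] subtracts from each row the preceding one, which clears the first column
    below its top entry. *)
Lemma det_first_col1 (R : comNzRingType) k (A : 'M[R]_k.+1) :
  (forall i, A i ord0 = 1) ->
  \det A = \det (\matrix_(i < k, j < k) (A (lift ord0 i) (lift ord0 j) -
                                         A (widen_ord (leqnSn k) i) (lift ord0 j))).
Proof.
move=> A1; pose L : 'M[R]_k.+1 := \matrix_(i, l) ((l == i)%:R - (l.+1 == i :> nat)%:R).
have LA i j : (L *m A) i j = A i j - \sum_(l < k.+1 | l.+1 == i :> nat) A l j.
  rewrite mxE; under eq_bigr do rewrite mxE mulrBl.
  rewrite sumrB (bigD1 i) //= eqxx mul1r big1 ?addr0; last first.
    by move=> l /negbTE ->; rewrite mul0r.
  congr (_ - _); rewrite [RHS]big_mkcond; apply: eq_bigr => l _.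
  by case: ifP; rewrite ?mul1r ?mul0r.
have LAlift i j : (L *m A) (lift ord0 i) j = A (lift ord0 i) j - A (widen_ord (leqnSn k) i) j.
  rewrite LA; congr (_ - _); rewrite (big_pred1 (widen_ord (leqnSn k) i))//.
have detL : \det L = 1.
  rewrite det_trig.
    by rewrite big1 // => i _; rewrite mxE eqxx eqn_leq ltnn subr0.
  apply/is_trig_mxP => i j ij; rewrite mxE.
  have -> : (j == i) = false by apply/negbTE; rewrite -val_eqE neq_ltn ij orbT.
  have -> : (j.+1 == i :> nat) = false by apply/negbTE; rewrite neq_ltn ltnS (ltnW ij) orbT.
  by rewrite subrr.
rewrite -[LHS]mul1r -detL -det_mulmx (expand_det_col _ ord0) big_ord_recl.
rewrite big1 ?addr0 => [|i _]; last by rewrite LAlift !A1 subrr mul0r.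
rewrite LA A1 big_pred0 // subr0 mul1r /cofactor addn0 expr0 mul1r.
by congr (\det _); apply/matrixP=> i j; rewrite !mxE -LAlift !mxE.
Qed.

(** Falling factorials: a monic basis whose sums over intervals telescope to values of the next
    degree. *)
Definition ffact_poly (j : nat) : {poly rat} := \prod_(i < j) ('X - (i%:R)%:P).

Lemma monic_ffact_poly j : ffact_poly j \is monic.
Proof. by apply: monic_prod => i _; apply: monicXsubC. Qed.

Lemma size_ffact_poly j : size (ffact_poly j) = j.+1.
Proof. by rewrite size_prod_XsubC /index_enum -enumT size_enum_ord. Qed.

Lemma horner_ffact_polyS j x : (ffact_poly j.+1).[x] = (ffact_poly j).[x] * (x - j%:R).
Proof. by rewrite /ffact_poly big_ord_recr !hornerE. Qed.

Lemma ffact_poly_diff j x :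
  (ffact_poly j.+1).[x + 1] - (ffact_poly j.+1).[x] = j.+1%:R * (ffact_poly j).[x].
Proof.
have shift : (ffact_poly j.+1).[x + 1] = (x + 1) * (ffact_poly j).[x].
  rewrite /ffact_poly big_ord_recl !horner_prod hornerM subr0 hornerX horner_prod; congr (_ * _).
  by apply: eq_bigr => i _; rewrite !hornerE lift0 -addn1 natrD; ring.
by rewrite shift horner_ffact_polyS -natr1; ring.
Qed.

Lemma sum_ffact_poly j (l d : int) : l <= d + 1 ->
  \sum_(x <- irange l (absz (d + 1 - l)%R)) (ffact_poly j).[x%:~R] =
  ((ffact_poly j.+1).[(d + 1)%:~R] - (ffact_poly j.+1).[l%:~R]) / j.+1%:R.
Proof.
move=> ld; have [k Ek] : exists k, k = absz (d + 1 - l)%R by eexists.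
rewrite -Ek; have {Ek} -> : d + 1 = l + k%:Z by lia.
elim: k l {ld} => [|k IHk] l; first by rewrite big_nil addr0 subrr mul0r.
rewrite irangeS big_cons {}IHk.
have -> : l + 1 + k%:Z = l + k.+1%:Z by lia.
have := ffact_poly_diff j l%:~R; rewrite -(intrD _ l 1) => E.
apply: (@mulIf _ j.+1%:R); rewrite ?pnatr_eq0 // mulrDl !divfK ?pnatr_eq0 //.
by rewrite mulrC -E; ring.
Qed.

Definition det_rows (k : nat) (rows : seq 'rV[rat]_k) : rat :=
  \det (\matrix_(i < k) nth 0 rows i).

Lemma det_rows_sum k (I : Type) (r : seq I) (f : I -> 'rV[rat]_k) pre post :
  (size pre < k)%N ->
  det_rows (pre ++ (\sum_(x <- r) f x) :: post) =
  \sum_(x <- r) det_rows (pre ++ f x :: post).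
Proof.
move=> prek; pose i0 := Ordinal prek.
have at_i0 w : row i0 (\matrix_(i < k) nth 0 (pre ++ w :: post) i) = w.
  by rewrite rowK /= nth_cat ltnn subnn.
have off_i0 w w' : row' i0 (\matrix_(i < k) nth 0 (pre ++ w :: post) i) =
    row' i0 (\matrix_(i < k) nth 0 (pre ++ w' :: post) i).
  apply/row_matrixP => i; rewrite !row_rowsub !rowK !nth_cat.
  case: ltngtP => // [lt|E]; last first.
    by have /eqP[] := neq_lift i0 i; apply: val_inj; exact: (esym E).
  by case: (_ - _)%N (subn_gt0 (size pre) (lift i0 i)) => //; rewrite lt.
elim: r => [|x r IHr].
  (* A zero row is a combination of rows with both coefficients 0. *)
  rewrite !big_nil /det_rows -(mul0r (det_rows (pre ++ 0 :: post))) -[X in _ = X]addr0.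
  rewrite -[X in _ + X](mul0r (det_rows (pre ++ 0 :: post))).
  by apply: (determinant_multilinear (i0 := i0)); rewrite ?at_i0 // !scaler0 addr0.
rewrite !big_cons -IHr /det_rows.
pose m w : 'M[rat]_k := \matrix_(i < k) nth 0 (pre ++ w :: post) i.
have := @determinant_multilinear _ _ (m (f x + \sum_(y <- r) f y)) (m (f x))
  (m (\sum_(y <- r) f y)) i0 1 1.
by rewrite /m !at_i0 !scale1r !mul1r => -> //; apply: off_i0.
Qed.

Fixpoint interval_sums k (v : int -> 'rV[rat]_k) (l : int) (D : seq int) :=
  if D is d :: D' then
    (\sum_(x <- irange l (absz (d + 1 - l)%R)) v x) :: interval_sums v (d + 1) D'
  else [::].

(** By multilinearity each nested sum moves into its own row; [pre] holds the rows whose summation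
    variable is already fixed. *)
Lemma sum_below_det k (v : int -> 'rV[rat]_k) l D pre : (size pre + size D = k)%N ->
  sum_below l D (fun X => det_rows (pre ++ map v X)) =
  det_rows (pre ++ interval_sums v l D).
Proof.
elim: D l pre => [|d D IHD] l pre //= sz; rewrite det_rows_sum; last first.
  by apply: leq_trans (eq_leq sz); rewrite addnS ltnS leq_addr.
apply: eq_bigr => x _; rewrite -cat_rcons -IHD ?size_rcons ?addSnnS //.
by apply: eq_sum_below => X; rewrite cat_rcons.
Qed.

(** Pairs are ordered by value and not by position, which makes the product invariant under
    permutations of the list. *)
Definition vdm (D : seq int) : rat :=
  \prod_(p <- D) \prod_(q <- D | p < q) (q - p)%:~R.

Definition dent_count (D : seq int) : rat := vdm D / (hyperfact (size D))%:R.

Lemma hyperfact_neq0 n : (hyperfact n)%:R != 0 :> rat.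
Proof.
by rewrite pnatr_eq0 -lt0n prodn_gt0 // => i; apply: fact_gt0.
Qed.

Lemma hyperfactS n : hyperfact n.+1 = (hyperfact n * n`!)%N.
Proof. exact: big_ord_recr. Qed.

(** Differences ignore the translation [c]. Later [c = 0] serves for the summand and [c = 1] for the
    value of the sum, to match the interval ends [d + 1]. *)
Lemma vdm_sorted (c : int) (D : seq int) k : sorted <%R D -> size D = k ->
  vdm D = \det (\matrix_(i < k, j < k) (ffact_poly j).[(nth 0 D i + c)%:~R]).
Proof.
move=> sD <-; pose a := \row_(i < size D) (nth 0 D i + c)%:~R : 'rV[rat]_(size D).
have -> : \matrix_(i < size D, j < size D) (ffact_poly j).[(nth 0 D i + c)%:~R] =
          \matrix_(i, j) (ffact_poly j).[a 0 i].
  by apply/matrixP => i j; rewrite !mxE.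
rewrite (det_monic_basis _ monic_ffact_poly size_ffact_poly).
rewrite /vdm (big_nth 0) big_mkord; apply: eq_bigr => i _.
rewrite (big_nth 0) big_mkord; apply: eq_big => j.
  by rewrite (lt_sorted_ltn_nth 0 sD) ?inE.
by move=> _; rewrite !mxE -rmorphB; congr _%:~R; ring.
Qed.

Lemma nth_interval_sums k (v : int -> 'rV[rat]_k) d D i : (i < size D)%N ->
  nth 0 (interval_sums v (d + 1) D) i =
  \sum_(x <- irange (nth 0 (d :: D) i + 1) (absz (nth 0 D i - nth 0 (d :: D) i)%R)) v x.
Proof.
elim: D d i => // d' D IHD d [_|i iD] /=; last exact: IHD.
by congr (\sum_(x <- irange _ _) _); lia.
Qed.

Lemma sum_below_in l k D F G : in_range D l k ->
    (forall X, size X = size D -> in_range X l k -> F X = G X) ->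
  sum_below l D F = sum_below l D G.
Proof.
elim: D l k F G => [|d D IHD] l k F G rD FG; first exact: FG.
have rD' := in_range_tail rD.
have ld := rD.2 d (mem_head _ _).
apply: eq_big_seq => x; rewrite mem_irange => xld.
apply: (IHD _ _ _ _ rD') => X szX [sX rX]; apply: FG; first by rewrite /= szX.
split=> [|i].
  rewrite /= path_sortedE; last exact: lt_trans.
  by rewrite sX andbT; apply/allP => i /rX; lia.
by rewrite in_consz => /predU1P[->|/rX]; lia.
Qed.

Lemma sum_interlacing_in l k D F G : in_range D l k ->
    (forall X, (size X).+1 = size D -> in_range X (l + 1) k.-1 -> F X = G X) ->
  sum_interlacing D F = sum_interlacing D G.
Proof.
case: D => // d D rD FG; apply: (sum_below_in (in_range_tail rD)) => X szX [sX rX].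
have dl := rD.2 d (mem_head _ _).
by apply: FG; rewrite /= ?szX //; split=> // i /rX; lia.
Qed.

(** In the basis of falling factorials, summing over the intervals replaces column [j] by
    differences of values of degree [j + 1], divided by [j + 1]. The differences form the matrix
    that [det_first_col1] extracts from the determinant for [d :: D], and the divisors multiply to
    the quotient [k!] of the two hyperfactorials. *)
Lemma sum_interlacing_dent_count d D l m : in_range (d :: D) l m ->
  sum_interlacing (d :: D) dent_count = dent_count (d :: D).
Proof.
move=> rD; have sD := rD.1; set k := size D.
pose v x : 'rV[rat]_k := \row_j (ffact_poly j).[x%:~R].
rewrite (sum_interlacing_in (G := fun X => det_rows ([::] ++ map v X) / (hyperfact k)%:R) rD); last first.
  move=> X [szX] [sX _]; rewrite /dent_count szX (vdm_sorted 0 sX szX) /det_rows.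
  congr (\det _ / _); apply/matrixP => i j.
  by rewrite !mxE (nth_map 0) ?szX ?ltn_ord // !mxE addr0.
have linear c : forall l E F, sum_below l E (fun X => F X / c) = sum_below l E F / c.
  move=> p E; elim: E p => // e E IHE p F /=.
  by rewrite mulr_suml; apply: eq_bigr => x _; rewrite -IHE.
rewrite -[LHS]/(sum_below (d + 1) D (fun X => det_rows ([::] ++ map v X) / _)).
rewrite linear sum_below_det //= /dent_count (vdm_sorted 1 sD (erefl _)).
rewrite det_first_col1; last by move=> i; rewrite mxE /ffact_poly big_ord0 hornerC.
pose B : 'M[rat]_k := \matrix_(i, j)
  ((ffact_poly j.+1).[(nth 0 D i + 1)%:~R] - (ffact_poly j.+1).[(nth 0 (d :: D) i + 1)%:~R]).
transitivity (\det B / (hyperfact k.+1)%:R); last first.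
  by congr (\det _ / _); apply/matrixP => i j; rewrite !mxE !lift0.
have AB : \matrix_(i < k) nth 0 (interval_sums v (d + 1) D) i *m
          diag_mx (\row_(j < k) j.+1%:R) = B.
  apply/matrixP => i j; rewrite mul_mx_diag !mxE nth_interval_sums ?ltn_ord //.
  rewrite summxE; under eq_bigr do rewrite mxE.
  have lt : nth 0 (d :: D) i < nth 0 (d :: D) i.+1.
    by rewrite (lt_sorted_ltn_nth 0 sD) ?inE /= ?ltnS // ltnW.
  have := @sum_ffact_poly j (nth 0 (d :: D) i + 1) (nth 0 D i).
  have -> : nth 0 D i + 1 - (nth 0 (d :: D) i + 1) = nth 0 D i - nth 0 (d :: D) i by ring.
  by move=> -> //; [rewrite divfK ?pnatr_eq0 | move: lt => /=; lia].
rewrite -AB det_mulmx det_diag /= hyperfactS natrM.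
have -> : \prod_(j < k) (\row_(j < k) (j.+1%:R : rat)) 0 j = (k`!)%:R.
  rewrite fact_prod big_add1 big_mkord natr_prod.
  by apply: eq_bigr => j _; rewrite mxE.
by rewrite -mulf_div divff ?mulr1 // pnatr_eq0 -lt0n fact_gt0.
Qed.

(** * Trapezoids with dents *)

Lemma vdm_perm D E : perm_eq D E -> vdm D = vdm E.
Proof.
move=> DE; rewrite /vdm (perm_big _ DE); apply: eq_bigr => p _; exact: perm_big.
Qed.

Lemma dent_count_perm D E : perm_eq D E -> dent_count D = dent_count E.
Proof. by move=> DE; rewrite /dent_count (vdm_perm DE) (perm_size DE). Qed.

(* The trapezoid with rows [j], [j - 1], ..., [j - n + 1] whose longer side, of
   length [w], is its top side. *)
Fixpoint trapezoid (l : int) (w : nat) (j : int) (n : nat) : {fset triangle} :=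
  if n is n'.+1 then
    (strip l w (l + 1) w.-1 j [::] `|` trapezoid (l + 1) w.-1 (j - 1) n')%fset
  else fset0.

Lemma in_trapezoid l w j n (i h : int) p :
  (((i, h), p) \in trapezoid l w j n) =
  [&& j - n%:Z < h, h <= j, l + (j - h) + p%:Z <= i & i < l + w%:Z].
Proof.
elim: n l w j => [|n IHn] l w j /=; first by rewrite in_fset0; lia.
by rewrite in_fsetU in_strip {}IHn in_nil; case: p => /=; lia.
Qed.

(** Everything is forced. To the left of the dent each down-pointing triangle pairs with its right
    neighbour, to the right of it each up-pointing one does. *)
Lemma M_single_row j l w d : l <= d < l + w%:Z ->
  M (strip l w (l + 1) w.-1 j [:: d]) = 1%N.
Proof.
have full k c : M (strip c k c k j [::]) = 1%N.
  elim: k c => [|k IHk] c.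
    rewrite -[RHS]M0; congr M; apply: triangle_fsetP => i h p.
    by rewrite in_strip [RHS]in_fset0; case: p; lia.
  rewrite (@M_forced _ (up c j) (dn c j)); first 1 last.
  - by rewrite in_strip ?in_nil; lia.
  - by rewrite in_strip ?in_nil; lia.
  - by rewrite share_edgeE; lia.
  - move=> [[i h] []]; rewrite in_strip share_edgeE // => ic adj.
    by congr (dn _ _); lia.
  rewrite -[RHS](IHk (c + 1)); congr M; apply: triangle_fsetP => i h p.
  by rewrite !in_fsetD1 !in_strip !in_nil !xpair_eqE; case: p => /=; lia.
elim: w l => [|w IHw] l ld; first by lia.
have [Ed|dl] := eqVneq d l.
  rewrite -[RHS](full w (l + 1)); congr M; apply: triangle_fsetP => i h p.
  by rewrite !in_strip in_consz in_nil; case: p => /=; lia.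
case: w IHw ld => [|w] IHw ld; first by lia.
rewrite (@M_forced _ (dn l j) (up (l + 1) j)); first 1 last.
- by rewrite in_strip in_consz in_nil; lia.
- by rewrite in_strip; lia.
- by rewrite share_edgeE; lia.
- move=> [[i h] []]; rewrite in_strip share_edgeE // => ic adj.
  by congr (up _ _); lia.
rewrite -(IHw (l + 1)); last by lia.
congr M; apply: triangle_fsetP => i h p.
by rewrite !in_fsetD1 !in_strip in_consz in_nil !xpair_eqE; case: p => /=; lia.
Qed.

Lemma M_trapezoid_sorted l w j n D : in_range D l w -> size D = n ->
  (M (trapezoid l w j n `\` dns D j)%fset)%:R = dent_count D.
Proof.
elim: n l w j D => [|n IHn] l w j [|d D] // rD.
  by move=> _; rewrite /= fset0D M0 /dent_count /vdm big_nil /hyperfact big_ord0 divr1.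
case=> szD; have ld := rD.2 d (mem_head _ _).
case: w rD ld => [|w] rD ld; first by lia.
have -> : (trapezoid l w.+1 j n.+1 `\` dns (d :: D) j =
   strip l w.+1 (l + 1) w j (d :: D) `|` trapezoid (l + 1) w (j - 1) n)%fset.
  apply: triangle_fsetP => i h p.
  rewrite in_fsetD in_dns in_trapezoid [RHS]in_fsetU in_strip in_trapezoid.
  by case: p => /=; lia.
(* The last row is treated apart, since [peel_row] needs down-pointing triangles beneath the row. *)
case: n IHn szD => [|n] IHn szD.
  case: D szD rD => // _ rD; rewrite /= fsetU0.
  rewrite (@M_single_row _ _ w.+1) // /dent_count /vdm !big_seq1 big_cons big_nil ltxx.
  by rewrite /hyperfact big_ord_recr big_ord0 divr1.
rewrite peel_row //.
  rewrite -(sum_interlacing_dent_count rD); apply: (sum_interlacing_in rD).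
  by move=> X [szX] rX; rewrite IHn // szX.
split=> [i h p|i ic]; rewrite in_trapezoid; lia.
Qed.

Lemma M_trapezoid l w j n D : uniq D -> {in D, forall i, l <= i < l + w%:Z} ->
  size D = n -> (M (trapezoid l w j n `\` dns D j)%fset)%:R = dent_count D.
Proof.
move=> uD rD szD; set E := sort <=%R D.
have DE : perm_eq E D by rewrite perm_sort.
rewrite -(dent_count_perm DE) -(@M_trapezoid_sorted l w j n E).
- congr (M (_ `\` _)%fset)%:R; apply: triangle_fsetP => i h p.
  by rewrite !in_dns mem_sort.
- split; last by move=> i; rewrite mem_sort => /rD.
  by rewrite lt_sorted_uniq_le sort_uniq uD sort_le_sorted.
- by rewrite size_sort.
Qed.

(** * Forced lozenges inside the lobes *)

Lemma M_forced_row (R : {fset triangle}) (q j : int) (k : nat) :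
    (forall i, q - 1 <= i < q + k%:Z -> dn i j \notin R) ->
    (forall i, q <= i < q + k%:Z -> up i j \in R /\ dn i (j - 1) \in R) ->
  M R = M (R `\` strip q 0 q k j [::] `\` dns (irange q k) (j - 1))%fset.
Proof.
elim: k q R => [|k IHk] q R noR inR.
  congr M; apply: triangle_fsetP => i h p.
  rewrite !in_fsetD in_dns in_strip mem_irange; case: (_ \in R); case: p => /=; lia.
have [uq dq] := inR q ltac:(lia).
(* Both row neighbours [dn (q - 1) j] and [dn q j] of [up q j] are missing; the first of them is why
   the hypothesis starts at [q - 1]. *)
rewrite (M_forced uq dq); first 1 last.
- by rewrite share_edgeE; lia.
- move=> [[i h] []]; rewrite share_edgeE // => ihR adj; congr (dn _ _); first 1 last.
    have [//|hj] := eqVneq h (j - 1).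
    have := noR i; have -> : j = h by lia.
    by rewrite ihR => /(_ ltac:(lia)).
  have [//|iq] := eqVneq i q.
  have := noR i; have -> : j = h by lia.
  by rewrite ihR => /(_ ltac:(lia)).
rewrite (IHk (q + 1)).
- congr M; apply: triangle_fsetP => i h p.
  rewrite !(in_fsetD, in_fset1) !in_dns !in_strip !mem_irange !xpair_eqE in_nil.
  by case: (_ \in R); case: p => /=; lia.
- by move=> i iq; rewrite !in_fsetD1 (negbTE (noR i _)) ?andbF //; lia.
- move=> i iq; have [|u d] := inR i; first lia.
  by rewrite !in_fsetD1 u d !xpair_eqE; split; lia.
Qed.

(** [trapezoid p k j k] is a down-pointing triangle of side [k]. Once its top side is dented, the
    up-pointing triangles of its top row are forced downwards, which dents a run shorter by one in
    the next row. *)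
Lemma M_lobe (R : {fset triangle}) p k j :
    (forall i, p <= i < p + k%:Z -> dn i j \notin R) ->
    (forall (i h : int) b, ((i, h), b) \in trapezoid p k j k ->
       (h < j) || b -> ((i, h), b) \in R) ->
  M R = M (R `\` trapezoid p k j k)%fset.
Proof.
elim: k p j R => [|k IHk] p j R noR inR; first by rewrite fsetD0.
rewrite (@M_forced_row R (p + 1) j k); first 1 last.
- by move=> i ip; apply: noR; lia.
- by move=> i ip; split; apply: inR; rewrite ?in_trapezoid; lia.
rewrite (IHk (p + 1) (j - 1)).
- congr M; apply: triangle_fsetP => i h b.
  rewrite !in_fsetD !in_dns !in_strip !mem_irange !in_trapezoid in_nil.
  case iR: (_ \in R); last by rewrite !andbF.
  have [hj|hj] := eqVneq h j; last by case: b {iR} => /=; lia.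
  case: b iR => /=; first by lia.
  rewrite hj => iR; suff : ~~ (p <= i < p + k.+1%:Z) by lia.
  by apply: contraL iR; apply: noR.
- move=> i ip; rewrite in_fsetD in_dns mem_irange; lia.
- move=> i h b; rewrite in_trapezoid => ih hb.
  rewrite !in_fsetD in_dns in_strip mem_irange inR ?in_trapezoid; lia.
Qed.

(** The list cuts a lattice line into consecutive segments, alternately dented and free; [b] says
    whether the first one is dented. *)
Fixpoint blocks (b : bool) (p : int) (c : seq nat) : seq int :=
  if c is k :: c' then
    (if b then irange p k else [::]) ++ blocks (~~ b) (p + k%:Z) c'
  else [::].

Fixpoint lobes (b : bool) (p : int) (c : seq nat) (j : int) : {fset triangle} :=
  if c is k :: c' then
    ((if b then trapezoid p k j k else fset0) `|` lobes (~~ b) (p + k%:Z) c' j)%fset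
  else fset0.

Lemma mem_blocks b p c (i : int) : i \in blocks b p c -> p <= i < p + (sumn c)%:Z.
Proof.
elim: c b p => //= k c IHc b p; rewrite mem_cat => /orP[|/IHc]; last by lia.
by case: b; rewrite ?in_nil ?mem_irange; lia.
Qed.

Lemma blocks_uniq b p c : uniq (blocks b p c).
Proof.
elim: c b p => //= k c IHc b p; rewrite cat_uniq IHc andbT.
case: b => /=; last by apply/hasPn => i.
by rewrite irange_uniq; apply/hasPn => i /mem_blocks; rewrite mem_irange; lia.
Qed.

Lemma in_lobes b p c j (i h : int) o : ((i, h), o) \in lobes b p c j ->
  [&& j - (size (blocks b p c))%:Z < h, h <= j,
      p + (j - h) + o%:Z <= i & i < p + (sumn c)%:Z].
Proof.
elim: c b p => //= k c IHc b p.
rewrite in_fsetU size_cat => /orP[|/IHc]; last by case: b; lia.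
case: b; last by rewrite in_fset0.
by rewrite in_trapezoid size_irange; lia.
Qed.

Lemma in_lobes_top b p c (j i : int) : (dn i j \in lobes b p c j) = (i \in blocks b p c).
Proof.
elim: c b p => //= k c IHc b p; rewrite in_fsetU mem_cat IHc; congr (_ || _).
by case: b; rewrite // in_trapezoid mem_irange /=; lia.
Qed.

Lemma M_lobes (R : {fset triangle}) b p c j :
    (forall i, i \in blocks b p c -> dn i j \notin R) ->
    (forall (i h : int) o, ((i, h), o) \in lobes b p c j ->
       (h < j) || o -> ((i, h), o) \in R) ->
  M R = M (R `\` lobes b p c j)%fset.
Proof.
elim: c b p R => [|k c IHc] b p R noR inR; first by rewrite fsetD0.
rewrite -fsetDDl -IHc.
- case: b noR inR => noR inR; last by rewrite fsetD0.
  apply: M_lobe => [i ip|i h o ih].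
    by apply: noR; rewrite /= mem_cat mem_irange ip.
  by apply: inR; rewrite /= in_fsetU ih.
- move=> i ic; rewrite in_fsetD negb_and noR ?orbT //=.
  by rewrite mem_cat ic orbT.
- move=> i h o ih hj; rewrite in_fsetD inR //; last by rewrite /= in_fsetU ih orbT.
  have := in_lobes ih; case: b {noR inR ih}; last by rewrite in_fset0.
  by rewrite in_trapezoid; lia.
Qed.

(** Common shape of the two halves of a region, the upper one after reflection. The lobes are those
    of the ferns together with the triangles that complete the half to a trapezoid. *)
HB.lock Definition dented_half (p : int) (c : seq nat) (j : int) (n : nat) : {fset triangle} :=
  (trapezoid p (sumn c) j n `\` lobes true p c j)%fset.

Lemma in_dented_half p c j n u : (u \in dented_half p c j n) =
  (u \notin lobes true p c j) && (u \in trapezoid p (sumn c) j n).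
Proof. by rewrite unlock in_fsetD. Qed.

(** The count is known for the trapezoid with unit dents; there the lozenges inside the lobes are
    forced, and removing them leaves the dented half. *)
Lemma M_dented_half p c j n (S : seq int) :
    uniq S -> {in S, forall i, p <= i < p + (sumn c)%:Z} ->
    {in S, forall i, i \notin blocks true p c} ->
    (size (blocks true p c) + size S = n)%N ->
  (M (dented_half p c j n `\` dns S j)%fset)%:R = dent_count (blocks true p c ++ S).
Proof.
move=> uS rS dS szn; rewrite unlock -(@M_trapezoid p (sumn c) j n); first 1 last.
- rewrite cat_uniq uS blocks_uniq andbT; apply/hasPn => i; exact: dS.
- by move=> i; rewrite mem_cat => /orP[/mem_blocks//|/rS].
- by rewrite size_cat.
congr (_%:R); rewrite [RHS](@M_lobes _ true p c j).
- congr M; apply: triangle_fsetP => i h o.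
  rewrite !in_fsetD !in_dns mem_cat.
  have [ihL|ihL] := boolP (_ \in lobes _ _ _ _); first by rewrite !andbF.
  have [ih|] := boolP (_ \in trapezoid _ _ _ _); last by rewrite !andbF.
  case: o ihL ih => //= ihL ih; rewrite andbT andbT.
  have [Ehj|//] := eqVneq h j.
  by rewrite Ehj in_lobes_top in ihL; rewrite (negbTE ihL).
- move=> i ic; rewrite in_fsetD in_dns mem_cat ic eqxx /=; exact: isT.
- move=> i h o ihL hj; rewrite in_fsetD in_dns mem_cat in_trapezoid.
  have := in_lobes ihL; case: o hj ihL => hj ihL /=; lia.
Qed.

(** * Cutting along the axis *)

(* Reflection across the lattice line at height [x]. *)
Definition refl (x : int) (u : triangle) : triangle :=
  let: ((i, j), o) := u in
  ((i + j - x + (~~ o)%:Z, 2 * x - 1 - j), ~~ o).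

Lemma reflK x : involutive (refl x).
Proof. by move=> [[i j] []] /=; congr (_, _, _) => /=; lia. Qed.

Lemma share_edge_refl x : {mono refl x : u v / share_edge u v}.
Proof. by move=> [[i j] []] [[k l] []]; rewrite /refl /= !share_edgeE; lia. Qed.

Definition mirror (x : int) (R : {fset triangle}) : {fset triangle} :=
  [fset refl x u | u in R]%fset.

Lemma in_mirror x R u : (u \in mirror x R) = (refl x u \in R).
Proof.
apply/imfsetP/idP => [[v /= vR ->]|uR]; first by rewrite reflK.
by exists (refl x u); rewrite ?reflK.
Qed.

Lemma M_mirror x R : M (mirror x R) = M R.
Proof. apply: M_imfset; [exact: inv_inj (reflK x) | exact: share_edge_refl]. Qed.

Lemma vdm_neq0 D : vdm D != 0.
Proof.
rewrite /vdm prodf_seq_neq0; apply/allP => p _; rewrite prodf_seq_neq0.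
by apply/allP => q _; apply/implyP => pq; rewrite intr_eq0; lia.
Qed.

Lemma dent_count_neq0 D : dent_count D != 0.
Proof. by rewrite mulf_neq0 ?vdm_neq0 // invr_eq0 hyperfact_neq0. Qed.

(** Dents remove only down-pointing triangles, so the balance of a tileable dented region determines
    their number. *)
Lemma M_dents_balanced (R : {fset triangle}) (X : seq int) j : uniq X ->
    {in X, forall i, dn i j \in R} -> M (R `\` dns X j)%fset != 0%N ->
  downs R = (ups R + size X)%N.
Proof.
move=> uX rX /M_balanced.
suff [-> ->] : ups (R `\` dns X j)%fset = ups R /\
    downs R = (downs (R `\` dns X j)%fset + size X)%N by move->.
elim: X R uX rX => [|i X IHX] R /=.
  have -> : (R `\` dns [::] j = R)%fset.
    by apply: triangle_fsetP => i h o; rewrite in_fsetD in_dns in_nil !andbF.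
  by rewrite addn0.
case/andP=> iX uX rX.
have iR : dn i j \in R by apply: rX; rewrite mem_head.
have -> : (R `\` dns (i :: X) j = R `\ dn i j `\` dns X j)%fset.
  apply: triangle_fsetP => k h o; rewrite !in_fsetD in_fset1 !in_dns in_consz !xpair_eqE.
  by case: (_ \in R); case: o; rewrite ?andbF //=; lia.
have [|-> E] := IHX (R `\ dn i j)%fset uX.
  move=> k kX; rewrite in_fsetD1 rX ?in_cons ?kX ?orbT // !xpair_eqE.
  have ki : k != i by apply: contraNneq iX => <-.
  by rewrite (negbTE ki).
rewrite /ups /downs !(count_fsetD1 _ iR) /= add0n; split=> //.
by move: E; rewrite /downs => ->; rewrite addnS.
Qed.

Definition gap_points (q : int) (N : nat) (S : {set 'I_N}) : seq int :=
  [seq q + (nat_of_ord i)%:Z | i <- enum S].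

Lemma mem_gap_points q N (S : {set 'I_N}) (i : int) :
  reflect (exists2 k : 'I_N, k \in S & i = q + (k : nat)%:Z) (i \in gap_points q S).
Proof.
by apply: (iffP mapP) => -[k]; exists k; rewrite ?mem_enum // -mem_enum.
Qed.

Lemma gap_points_uniq q N (S : {set 'I_N}) : uniq (gap_points q S).
Proof.
rewrite map_inj_uniq ?enum_uniq // => i k E; apply: val_inj => /=; lia.
Qed.

Lemma size_gap_points q N (S : {set 'I_N}) : size (gap_points q S) = #|S|.
Proof. by rewrite size_map -cardE. Qed.

Section TwoHalves.

Variables (x pu pd q : int) (cu cd : seq nat) (nu nd N y : nat).

Let open p c (i : int) :=
  (p <= i < p + (sumn c)%:Z) && (i \notin blocks true p c).

Hypothesis gap : forall i, open pu cu i && open pd cd i = (q <= i < q + N%:Z).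
Hypotheses (size_u : (size (blocks true pu cu) + y = nu)%N)
           (size_d : (size (blocks true pd cd) + y = nd)%N) (yN : (y <= N)%N).

Let Top := mirror x (dented_half pu cu (x - 1) nu).
Let Bot := dented_half pd cd (x - 1) nd.

Let in_half p c n (i h : int) o : ((i, h), o) \in dented_half p c (x - 1) n ->
  h <= x - 1 /\ (~~ o -> h = x - 1 -> open p c i).
Proof.
rewrite in_dented_half in_trapezoid => /andP[ihL /and4P[_ hx ip ic]]; split=> //.
case: o ihL ip => // ihL ip _ Eh; rewrite Eh in ihL ip; rewrite /open -(in_lobes_top true p c (x - 1)) ihL andbT.
by move: ip ic => /=; lia.
Qed.

Let open_half p c n i : (0 < n)%N -> open p c i -> dn i (x - 1) \in dented_half p c (x - 1) n.
Proof.
by move=> n0 /andP[ip ic]; rewrite in_dented_half in_lobes_top ic in_trapezoid /=; lia.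
Qed.

Let gap_open (k : 'I_N) : open pu cu (q + (k : nat)%:Z) /\ open pd cd (q + (k : nat)%:Z).
Proof. by apply/andP; rewrite gap; have := ltn_ord k; lia. Qed.

Let cross_u (k : 'I_N) : triangle := up (q + (k : nat)%:Z) x.
Let cross_d (k : 'I_N) : triangle := dn (q + (k : nat)%:Z) (x - 1).

Let refl_cross k : refl x (cross_u k) = cross_d k.
Proof. by rewrite /refl /cross_u /cross_d /=; congr (_, _, _); lia. Qed.

Let gap_halves p c n (S : {set 'I_N}) : (forall k : 'I_N, open p c (q + (k : nat)%:Z)) ->
    (size (blocks true p c) + y = n)%N -> #|S| = y ->
  (M (dented_half p c (x - 1) n `\` dns (gap_points q S) (x - 1))%fset)%:R =
  dent_count (blocks true p c ++ gap_points q S).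
Proof.
move=> gapc szn Sy; apply: M_dented_half; rewrite ?gap_points_uniq ?size_gap_points ?Sy //.
- by move=> i /mem_gap_points[k _ ->]; case/andP: (gapc k).
- by move=> i /mem_gap_points[k _ ->]; case/andP: (gapc k).
Qed.

(** [M_split] sums over all sets of crossings. The balance of the lower half leaves those with [y]
    elements, for which each half has as many dents as rows. *)
Lemma M_two_halves :
  (M (Top `|` Bot)%fset)%:R =
  \sum_(S : {set 'I_N} | #|S| == y)
    dent_count (blocks true pu cu ++ gap_points q S) *
    dent_count (blocks true pd cd ++ gap_points q S).
Proof.
have u_inj : injective cross_u by move=> k l [E]; apply: val_inj => /=; lia.
have d_inj : injective cross_d by move=> k l [E]; apply: val_inj => /=; lia.
rewrite (@M_split _ cross_u cross_d) //; first 1 last.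
- by move=> k; rewrite share_edgeE; lia.
- apply/fdisjointP => -[[i h] o]; rewrite in_mirror /=.
  by move=> /in_half[h1 _]; apply/negP => /in_half[h2 _]; lia.
- move=> [[i h] o] [[k l] o']; rewrite in_mirror /= => /in_half[h1 i1] /in_half[h2 i2].
  rewrite share_edgeE; case: o o' h1 i1 h2 i2 => [] [] //= h1 i1 h2 i2 adj; last by lia.
  have Eh : h = x by lia.
  have El : l = x - 1 by lia.
  have Ek : k = i by lia.
  subst h l k; have oi : open pu cu i.
    by have := i1 isT ltac:(lia); congr (is_true (open _ _ _)); lia.
  have /esym := gap i; rewrite oi i2 //= => /andP[qi iq].
  have iN : (absz (i - q)%R < N)%N by lia.
  exists (Ordinal iN); rewrite /cross_u /cross_d /=; split; congr (_, _, _); lia.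
have topE (S : {set 'I_N}) : M (Top `\` [fset cross_u i | i in S])%fset =
    M (dented_half pu cu (x - 1) nu `\` dns (gap_points q S) (x - 1))%fset.
  rewrite -(M_mirror x); congr M; apply: triangle_fsetP => i h o.
  rewrite in_mirror !in_fsetD in_mirror reflK; congr (~~ _ && _).
  apply/imfsetP/idP => [[k kS /(congr1 (refl x))]|].
    rewrite reflK refl_cross => -[-> -> ->]; rewrite in_dns eqxx; apply/mem_gap_points.
    by exists k.
  rewrite in_dns => /and3P[oo /eqP -> /mem_gap_points[k kS ->]]; exists k => //.
  by rewrite -[RHS](reflK x) refl_cross /cross_d (negbTE oo).
have botE (S : {set 'I_N}) : (Bot `\` [fset cross_d i | i in S])%fset =
    (Bot `\` dns (gap_points q S) (x - 1))%fset.
  apply: triangle_fsetP => i h o; rewrite !in_fsetD; congr (~~ _ && _).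
  apply/imfsetP/idP => [[k /= kS [-> -> ->]]|].
    rewrite in_dns eqxx; apply/mem_gap_points; by exists k.
  rewrite in_dns => /and3P[oo /eqP -> /mem_gap_points[k kS ->]]; exists k => //.
  by rewrite /cross_d (negbTE oo).
have balanced (S : {set 'I_N}) : {in S, forall k, cross_d k \in Bot} ->
    M (Bot `\` dns (gap_points q S) (x - 1))%fset != 0%N -> downs Bot = (ups Bot + #|S|)%N.
  move=> SB; rewrite -(size_gap_points q); apply: M_dents_balanced.
    exact: gap_points_uniq.
  by move=> i /mem_gap_points[k kS ->]; apply: SB.
have crossing (S : {set 'I_N}) : #|S| = y ->
    [forall k in S, (cross_u k \in Top) && (cross_d k \in Bot)].
  move=> Sy; apply/forall_inP => k kS; have [ou od] := gap_open k.
  have y0 : (0 < y)%N by rewrite -Sy; apply/card_gt0P; exists k.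
  by rewrite in_mirror refl_cross !open_half //; rewrite -?size_u -?size_d; lia.
(* One set with [y] elements, whose lower half has a non-zero count, reveals the excess of
   down-pointing triangles in [Bot]. *)
have [S0 S0y] : exists S : {set 'I_N}, #|S| = y.
  exists [set widen_ord yN k | k : 'I_y]; rewrite card_imset ?card_ord //.
  by move=> k l /(congr1 val) /= E; apply: val_inj.
have balS0 : downs Bot = (ups Bot + y)%N.
  rewrite -S0y; apply: balanced.
    by move=> k kS; have /forall_inP/(_ k kS)/andP[] := crossing _ S0y.
  rewrite -(@pnatr_eq0 rat) gap_halves //; first exact: dent_count_neq0.
  by move=> k; case: (gap_open k).
(* Any other number of crossings leaves the lower half unbalanced, hence without tilings. *)
rewrite natr_sum (bigID (fun S : {set 'I_N} => #|S| == y)) /= [X in _ + X]big1 ?addr0; last first.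
  move=> S /andP[/forall_inP SR Sy]; rewrite botE; apply/eqP; rewrite pnatr_eq0 muln_eq0.
  apply/orP; right; apply/negPn/negP => /balanced E; move/eqP: Sy; apply.
  by apply/(@addnI (ups Bot)); rewrite -balS0 -E // => k kS; case/andP: (SR k kS).
apply: eq_big => [S|S /andP[_ /eqP Sy]].
  by apply: andb_idl => /eqP; apply: crossing.
rewrite natrM topE botE !gap_halves // => k; by case: (gap_open k).
Qed.

End TwoHalves.

(** * Vandermonde products and hyperfactorials *)

Local Notation H n := ((hyperfact n%N)%:R : rat).

(** A pair of equal entries contributes 1, as it does in [vdm]; thus [vdm_cat] holds for all lists
    and [cross] never vanishes. *)
Definition cross (A B : seq int) : rat :=
  \prod_(a <- A) \prod_(b <- B) (if a == b then 1 else `|a - b|%:~R).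

Lemma cross_catl A A' B : cross (A ++ A') B = cross A B * cross A' B.
Proof. exact: big_cat. Qed.

Lemma crossC A B : cross A B = cross B A.
Proof.
rewrite /cross exchange_big; apply: eq_bigr => b _; apply: eq_bigr => a _.
by rewrite eq_sym distrC.
Qed.

Lemma cross_catr A B B' : cross A (B ++ B') = cross A B * cross A B'.
Proof. by rewrite !(crossC A) cross_catl. Qed.

Lemma cross_perml A A' B : perm_eq A A' -> cross A B = cross A' B.
Proof. exact: perm_big. Qed.

Lemma cross_nilr A : cross A [::] = 1.
Proof. by rewrite crossC /cross big_nil. Qed.

Lemma vdm_cat A B : vdm (A ++ B) = vdm A * vdm B * cross A B.
Proof.
have crossE : cross A B = (\prod_(a <- A) \prod_(b <- B | a < b) (b - a)%:~R) *
                          (\prod_(b <- B) \prod_(a <- A | b < a) (a - b)%:~R).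
  rewrite [X in _ * X](exchange_big_dep xpredT) //= -big_split.
  apply: eq_bigr => a _ /=; rewrite [X in X * _]big_mkcond [X in _ * X]big_mkcond.
  rewrite -big_split; apply: eq_bigr => b _ /=.
  case: ltgtP => [ab|ba|_]; rewrite ?mulr1 ?mul1r //.
    by rewrite ltr0_norm ?subr_lt0 // opprB.
  by rewrite gtr0_norm ?subr_gt0.
rewrite crossE /vdm big_cat /=.
under eq_bigr do rewrite big_cat.
under [X in _ * X]eq_bigr do rewrite big_cat.
by rewrite !big_split /=; ring.
Qed.

Lemma vdm_irange p k : vdm (irange p k) = H k.
Proof.
elim: k p => [|k IHk] p; first by rewrite /vdm big_nil /hyperfact big_ord0.
rewrite irangeS -cat1s vdm_cat IHk /vdm /cross !big_seq1 big_cons big_nil ltxx mul1r.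
rewrite hyperfactS natrM; congr (_ * _).
(* The distances from [p] to the rest of the run are consecutive integers; the factor [m!] makes the
   induction on its length possible. *)
have shift : forall m l, \prod_(b <- irange (p + m.+1%:Z) l)
    (if p == b then 1 else `|p - b|%:~R) * (m`!)%:R = ((m + l)`!)%:R :> rat.
  move=> m l; elim: l m => [|l IHl] m; first by rewrite big_nil mul1r addn0.
  rewrite irangeS big_cons.
  have -> : p + m.+1%:Z + 1 = p + m.+2%:Z by lia.
  have -> : (p == p + m.+1%:Z) = false by lia.
  have -> : `|p - (p + m.+1%:Z)| = m.+1%:Z by lia.
  by rewrite addnS -addSn -IHl factS natrM -pmulrn; ring.
by have := shift 0%N k; rewrite mulr1 add0n.
Qed.

Lemma irange_cat p k l : irange p (k + l) = irange p k ++ irange (p + k%:Z) l.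
Proof.
rewrite /irange iotaD map_cat add0n -[X in iota X l](addn0 k) iotaDl -map_comp.
by congr (_ ++ _); apply: eq_map => i /=; lia.
Qed.

Lemma cross_neq0 A B : cross A B != 0.
Proof.
rewrite /cross prodf_seq_neq0; apply/allP => a _; rewrite prodf_seq_neq0.
by apply/allP => b _; have [_|ab] /= := eqVneq a b; rewrite ?oner_neq0 // intr_eq0 normr_eq0 subr_eq0.
Qed.

(** A third run [Y] fills the gap. The Vandermonde products of the merged runs are hyperfactorials,
    and they determine the interaction of [X] and [Z]. *)
Lemma cross_irange p k g m :
  cross (irange p k) (irange (p + k%:Z + g%:Z) m) =
  H (k + g + m) * H g / (H (k + g) * H (g + m)).
Proof.
set X := irange p k; set Y := irange (p + k%:Z) g; set Z := irange (_ + g%:Z) m.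
have XY : H (k + g) = H k * H g * cross X Y.
  by rewrite -(vdm_irange p) irange_cat vdm_cat !vdm_irange.
have YZ : H (g + m) = H g * H m * cross Y Z.
  by rewrite -(vdm_irange (p + k%:Z)) irange_cat vdm_cat !vdm_irange.
have XYZ : H (k + g + m) = H (k + g) * H m * (cross X Z * cross Y Z).
  rewrite -(vdm_irange p) !irange_cat vdm_cat -irange_cat !vdm_irange PoszD addrA.
  by rewrite irange_cat cross_catl.
rewrite XYZ YZ XY.
by field; rewrite !cross_neq0 !hyperfact_neq0.
Qed.

Lemma vdm_two_blocks p l g r :
  vdm (irange p l ++ irange (p + l%:Z + g%:Z) r) =
  H l * H r * (H (l + g + r) * H g / (H (l + g) * H (g + r))).
Proof. by rewrite vdm_cat !vdm_irange cross_irange. Qed.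

(* Alternating product of the hyperfactorials of the sums of the initial
   segments of [c], all increased by [w]. *)
Fixpoint alt_prod (w : nat) (c : seq nat) : rat :=
  if c is k :: c' then H (w + k) / alt_prod (w + k) c' else 1.

Lemma alt_prod_neq0 w c : alt_prod w c != 0.
Proof.
elim: c w => [|k c IHc] w; first exact: oner_neq0.
by rewrite /= mulf_neq0 ?invr_neq0 ?hyperfact_neq0.
Qed.

Lemma alt_prodE w c : alt_prod w c =
  \prod_(j < size c) (if odd j then (H (w + csum c 0 j))^-1 else H (w + csum c 0 j)).
Proof.
elim: c w => [|k c IHc] w; first by rewrite big_ord0.
rewrite /= big_ord_recl /= /csum big_nat1 /= IHc -prodfV; congr (_ * _).
apply: eq_bigr => j _; rewrite /bump leq0n add1n /= big_nat_recl //= addnA.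
by case: odd; rewrite ?invrK.
Qed.

(** The double product of [s], grouped by the left index [i]. *)
Fixpoint tail_prod (c : seq nat) : rat :=
  if c is k :: c' then alt_prod 0 c * tail_prod c' else 1.

Lemma s_tail_prod c : s c = tail_prod c / H (osum c).
Proof.
rewrite /s mulrC; congr (_ / _).
pose h (c : seq nat) i j : rat :=
  if odd (j - i) then (H (csum c i j))^-1 else H (csum c i j).
transitivity (\prod_(j < size c) \prod_(i < j.+1) h c i j).
  rewrite -prodf_div; apply: eq_bigr => j _.
  rewrite [RHS](bigID (fun i : 'I__ => odd (j - i).+1)) /= -prodfV; congr (_ * _).
    by apply: eq_bigr => i; rewrite /h /= => /negbTE ->.
  by apply: eq_bigr => i; rewrite /h /= negbK => ->.
elim: c => [|k c IHc]; first by rewrite big_ord0.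
rewrite [RHS]/= -IHc.
under eq_bigr do rewrite big_ord_recl /=.
rewrite big_split /=; congr (_ * _).
  rewrite -[RHS]/(alt_prod 0 (k :: c)) alt_prodE.
  by apply: eq_bigr => j _; rewrite /h subn0 add0n.
rewrite big_ord_recl big_ord0 mul1r; apply: eq_bigr => j _.
apply: eq_bigr => i _; rewrite -[LHS]/(h (k :: c) i.+1 j.+1) /h subSS.
by have -> : csum (k :: c) i.+1 j.+1 = csum c i j by rewrite /csum big_add1.
Qed.

(** The two alternating products collect the distances of the segment ends from the left and from
    the right end of the first run. The induction removes a dented and a free segment at a time,
    which enlarges [g] by both. *)
Lemma cross_blocks p k g c : odd (size c) ->
  cross (irange p k) (blocks true (p + k%:Z + g%:Z) c) =
  alt_prod (k + g) c / H (k + g) * (H g / alt_prod g c).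
Proof.
move: {2}(size c).+1 (ltnSn (size c)) => n.
elim: n g c => // n IHn g [|m [|g' c]] //= szc oc.
  by rewrite cats0 cross_irange !divr1; field; rewrite !hyperfact_neq0.
have -> : p + k%:Z + g%:Z + m%:Z + g'%:Z = p + k%:Z + (g + m + g')%:Z by lia.
rewrite cross_catr cross_irange IHn; [|by rewrite -ltnS ltnW|by rewrite negbK in oc].
rewrite !addnA; field.
by rewrite !hyperfact_neq0 !alt_prod_neq0.
Qed.

(** Splitting off the first dented run, its own Vandermonde product and its interaction with the
    rest give the first two factors of [tail_prod]. Since [osum c] counts the dents, [s c] is a dent
    count. *)
Lemma s_blocks p c : odd (size c) -> s c = vdm (blocks true p c) / H (osum c).
Proof.
rewrite s_tail_prod => oc; congr (_ / _).
move: {2}(size c).+1 (ltnSn (size c)) oc => n.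
elim: n p c => // n IHn p [|k [|g c]] //= szc oc.
  by rewrite cats0 vdm_irange divr1 mulr1.
rewrite negbK in oc; rewrite vdm_cat vdm_irange -IHn // ?cross_blocks //; last first.
  by rewrite -ltnS ltnW.
by rewrite add0n; field; rewrite !hyperfact_neq0 !alt_prod_neq0.
Qed.

(** * Ferns *)

Lemma osum_cons k c : osum (k :: c) = (k + esum c)%N.
Proof.
rewrite /osum /esum /= big_mkcond big_ord_recl /= [in RHS]big_mkcond; congr addn.
by apply: eq_bigr => i _; rewrite /= negbK.
Qed.

Lemma esum_cons k c : esum (k :: c) = osum c.
Proof.
rewrite /osum /esum /= big_mkcond big_ord_recl /= [in RHS]big_mkcond add0n.
by apply: eq_bigr => i _.
Qed.

Lemma osum_nil : osum [::] = 0%N. Proof. by rewrite /osum big_ord0. Qed.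
Lemma esum_nil : esum [::] = 0%N. Proof. by rewrite /esum big_ord0. Qed.

Lemma sumn_osum_esum c : sumn c = (osum c + esum c)%N.
Proof.
elim: c => [|k c IHc] /=; first by rewrite osum_nil esum_nil.
by rewrite IHc osum_cons esum_cons; lia.
Qed.

Lemma size_blocks b p c : size (blocks b p c) = if b then osum c else esum c.
Proof.
elim: c b p => [|k c IHc] [] p /=; rewrite ?osum_nil ?esum_nil // ?size_cat IHc.
  by rewrite size_irange osum_cons.
by rewrite esum_cons.
Qed.

Lemma blocks_cat b p c1 c2 : blocks b p (c1 ++ c2) =
  blocks b p c1 ++ blocks (b (+) odd (size c1)) (p + (sumn c1)%:Z) c2.
Proof.
elim: c1 b p => [|k c IHc] b p /=; first by rewrite addr0 addbF.
rewrite IHc catA -addrA PoszD; congr (_ ++ blocks _ _ _).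
by rewrite addNb addbN.
Qed.

Lemma lobes_cat b p c1 c2 j : lobes b p (c1 ++ c2) j =
  (lobes b p c1 j `|` lobes (b (+) odd (size c1)) (p + (sumn c1)%:Z) c2 j)%fset.
Proof.
elim: c1 b p => [|k c IHc] b p /=; first by rewrite addr0 addbF fset0U.
rewrite IHc fsetUA -addrA PoszD; congr (_ `|` lobes _ _ _ _)%fset.
by rewrite addNb addbN.
Qed.

Lemma perm_blocks p c :
  perm_eq (blocks true p c ++ blocks false p c) (irange p (sumn c)).
Proof.
apply/permP => f; elim: c p => //= k c IHc p.
rewrite irange_cat !count_cat -IHc !count_cat; lia.
Qed.

Lemma in_left_fern_cons b (p : point) k c u : in_left_fern b p (k :: c) u =
  inside (in_lobe b p k) u || in_left_fern (~~ b) (p.1 + k%:Z, p.2) c u.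
Proof.
rewrite /in_left_fern /= (iotaDl 1 0) has_map addbF addr0; congr (_ || _).
by apply: eq_has => i /=; rewrite addNb addbN PoszD addrA.
Qed.

Lemma in_left_fern_cat b (p : point) c1 c2 u : in_left_fern b p (c1 ++ c2) u =
  in_left_fern b p c1 u ||
  in_left_fern (b (+) odd (size c1)) (p.1 + (sumn c1)%:Z, p.2) c2 u.
Proof.
elim: c1 b p => [|k c IHc] b p /=.
  by rewrite addr0 addbF /in_left_fern /=; case: p.
by rewrite !in_left_fern_cons IHc orbA /= PoszD addrA addNb addbN.
Qed.

Lemma in_right_fern_cons b (p : point) k c u : in_right_fern b p (k :: c) u =
  inside (in_lobe b (p.1 - k%:Z, p.2) k) u || in_right_fern (~~ b) (p.1 - k%:Z, p.2) c u.
Proof.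
rewrite /in_right_fern /= (iotaDl 1 0) has_map addbF take0 /= addn0; congr (_ || _).
by apply: eq_has => i /=; rewrite addNb addbN PoszD opprD addrA.
Qed.

(** Read from left to right, the fern starts with its last lobe, whose orientation depends on the
    parity of the number of lobes. *)
Lemma in_right_fern_rev b (p : point) c u : in_right_fern b p c u =
  in_left_fern (b (+) ~~ odd (size c)) (p.1 - (sumn c)%:Z, p.2) (rev c) u.
Proof.
elim: c b p => [//|k c IHc] b p.
rewrite in_right_fern_cons rev_cons -cats1 in_left_fern_cat IHc orbC /= size_rev sumn_rev.
rewrite in_left_fern_cons orbF.
have -> : p.1 - (k + sumn c)%N%:Z + (sumn c)%:Z = p.1 - k%:Z by lia.
have -> : p.1 - (k + sumn c)%N%:Z = p.1 - k%:Z - (sumn c)%:Z by lia.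
by case: b; case: odd.
Qed.

(** Only lobes pointing down reach below the axis, hence the negation of [b]. *)
Lemma in_left_fern_below b (p x i h : int) o c : h < x ->
  in_left_fern b (p, x) c ((i, h), o) = (((i, h), o) \in lobes (~~ b) p c (x - 1)).
Proof.
move=> hx; elim: c b p => [//|k c IHc] b p.
rewrite in_left_fern_cons {}IHc /= in_fsetU; congr (_ || _).
rewrite /inside /in_lobe; case: b; last by rewrite in_trapezoid; case: o => /=; lia.
by rewrite in_fset0; case: o => /=; lia.
Qed.

Lemma in_left_fern_above b (p x i h : int) o c : x <= h ->
  in_left_fern b (p, x) c ((i, h), o) = (refl x ((i, h), o) \in lobes b p c (x - 1)).
Proof.
move=> hx; elim: c b p => [//|k c IHc] b p.
rewrite in_left_fern_cons {}IHc /= in_fsetU; congr (_ || _).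
rewrite /inside /in_lobe; case: b; first by rewrite in_trapezoid; case: o => /=; lia.
by rewrite in_fset0; case: o => /=; lia.
Qed.

Lemma osum_esum_rcons c k : osum (rcons c k) = (osum c + ~~ odd (size c) * k)%N /\
  esum (rcons c k) = (esum c + odd (size c) * k)%N.
Proof.
elim: c => [|l c [IHo IHe]] /=.
  by rewrite osum_cons esum_cons osum_nil esum_nil; lia.
by rewrite !osum_cons !esum_cons IHo IHe negbK; split; lia.
Qed.

Lemma osum_esum_rev c : osum (rev c) = (if odd (size c) then osum c else esum c) /\
  esum (rev c) = (if odd (size c) then esum c else osum c).
Proof.
elim: c => [|k c [IHo IHe]]; first by rewrite osum_nil esum_nil.
rewrite rev_cons; have [-> ->] := osum_esum_rcons (rev c) k.
rewrite IHo IHe osum_cons esum_cons size_rev /=.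
by case: odd => /=; split; lia.
Qed.

(** * Separating the ferns from the sum over the gap *)

Definition gap_sum (q : int) (N y : nat) (W : seq int) : rat :=
  \sum_(S : {set 'I_N} | #|S| == y)
    vdm (gap_points q S) ^+ 2 * cross W (gap_points q S).

(** The interactions of [S] with [U] and with [V] multiply to its interaction with their union; the
    square in [gap_sum] arises because [S] dents both halves. *)
Lemma sum_dent_counts (q : int) (N y : nat) (U V W : seq int) :
  perm_eq (U ++ V) W ->
  \sum_(S : {set 'I_N} | #|S| == y)
    dent_count (U ++ gap_points q S) * dent_count (V ++ gap_points q S) =
  vdm U * vdm V / (H (size U + y) * H (size V + y)) * gap_sum q N y W.
Proof.
move=> UVW; rewrite mulr_sumr; apply: eq_bigr => S /eqP Sy.
rewrite /dent_count !size_cat size_gap_points Sy !vdm_cat.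
rewrite -(cross_perml _ UVW) cross_catl.
by field; rewrite !hyperfact_neq0.
Qed.

Lemma vdm_shift q D : vdm [seq q + i | i <- D] = vdm D.
Proof.
rewrite /vdm big_map; apply: eq_bigr => i _; rewrite big_map.
apply: eq_big => k; first by rewrite ltrD2l.
by move=> _; congr (_%:~R); ring.
Qed.

Lemma cross_shift q A B : cross [seq q + i | i <- A] [seq q + i | i <- B] = cross A B.
Proof.
rewrite /cross big_map; apply: eq_bigr => i _; rewrite big_map.
apply: eq_bigr => k _; rewrite (inj_eq (addrI q)).
by have -> : q + i - (q + k) = i - k by ring.
Qed.

Lemma irange_shift q p k : irange (q + p) k = [seq q + i | i <- irange p k].
Proof. by rewrite /irange -map_comp; apply: eq_map => i /=; lia. Qed.

Lemma gap_sum_shift q N y W : gap_sum q N y [seq q + i | i <- W] = gap_sum 0 N y W.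
Proof.
apply: eq_bigr => S _.
have -> : gap_points q S = [seq q + i | i <- gap_points 0 S].
  by rewrite /gap_points -map_comp; apply: eq_map => i /=; rewrite add0r.
by rewrite vdm_shift cross_shift.
Qed.

Lemma gap_sum0 q N W : gap_sum q N 0 W = 1.
Proof.
rewrite /gap_sum (big_pred1 set0) => [|S]; last by rewrite cards_eq0.
have -> : gap_points q (set0 : {set 'I_N}) = [::] by rewrite /gap_points enum_set0.
by rewrite cross_nilr /vdm big_nil expr1n mulr1.
Qed.

(** * The two halves of the regions *)

Section Regions.

Variables (x y z t : nat) (a' b' : seq nat) (k m : nat).
Hypotheses (odd_a : odd (size a')) (odd_b : odd (size b')).

Let a := rcons a' k.
Let b := rcons b' m.

(** The axis seen from above and from below, as alternately dented and free segments. From above,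
    the last lobes of both ferns point down and merge with the gap; from below, [x] and [t] are the
    sides of the completing triangles. These lists are the arguments of [s] in [Phi_even]. *)
Definition P_upper : seq nat := a' ++ (k + y + z + m)%N :: rev b'.
Definition P_lower : seq nat := x :: a ++ (y + z)%N :: rcons (rev b) t.

Lemma in_hexagon_P (i h : int) o :
  inside (in_hexagon (P_sides x y z t a b)) ((i, h), o) =
  [&& 0 <= i, h < (x + y + osum a + osum b)%N%:Z,
      i + h + (~~ o)%:Z < (x + y + z + sumn a + sumn b)%N%:Z,
      i < (y + z + t + sumn a + sumn b)%N%:Z,
      - (y + t + esum a + esum b)%N%:Z <= h & 0 <= i + h + (~~ o)%:Z].
Proof.
rewrite /inside /in_hexagon /right_of /= !cornerS corner0 !mulrn_point !sumn_osum_esum /=.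
by case: o => /=; lia.
Qed.

Lemma in_P (i h : int) o : (((i, h), o) \in P x y z t a b) =
  [&& inside (in_hexagon (P_sides x y z t a b)) ((i, h), o),
      ~~ in_left_fern true (0, x%:Z) a ((i, h), o) &
      ~~ in_left_fern false ((sumn a)%:Z + (y + z)%N%:Z, x%:Z) (rev b) ((i, h), o)].
Proof.
rewrite [LHS]in_fset [LHS]inE mem_hexagon //; last by case: (corner_P x y z t a b).
rewrite in_right_fern_rev size_rcons /= negbK odd_b.
suff -> : (P_right x y z t a b).1 - (sumn b)%:Z = (sumn a)%:Z + (y + z)%N%:Z by [].
rewrite /P_right !cornerS corner0 !mulrn_point /= !sumn_osum_esum; lia.
Qed.

(** The upper half of the hexagon is already a trapezoid; the lower half becomes one when corner
    triangles of sides [x] and [t] are added next to the axis. *)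
Lemma P_halves : P x y z t a b =
  (mirror x (dented_half 0 P_upper (x%:Z - 1) (y + osum a + osum b)) `|`
   dented_half (- x%:Z) P_lower (x%:Z - 1) (x + y + t + esum a + esum b))%fset.
Proof.
apply: triangle_fsetP => i h o.
have sum_u : sumn P_upper = (sumn a + sumn b + y + z)%N.
  by rewrite sumn_cat /= sumn_rev !sumn_rcons; lia.
have sum_d : sumn P_lower = (x + sumn a + sumn b + y + z + t)%N.
  by rewrite /= sumn_cat /= sumn_rcons sumn_rev; lia.
have lobes_d : lobes true (- x%:Z) P_lower (x%:Z - 1) =
    (trapezoid (- x%:Z) x (x%:Z - 1) x `|` lobes false 0 a (x%:Z - 1) `|`
     (lobes true ((sumn a)%:Z + (y + z)%N%:Z) (rev b) (x%:Z - 1) `|`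
      trapezoid ((sumn a)%:Z + (y + z)%N%:Z + (sumn b)%:Z) t (x%:Z - 1) t))%fset.
  rewrite /P_lower -cats1 /= addNr lobes_cat /= size_rcons /= odd_a fset0U add0r.
  by rewrite lobes_cat size_rev size_rcons /= odd_b sumn_rev fsetU0 fsetUA.
have lobes_u : lobes true 0 P_upper (x%:Z - 1) =
    (lobes true 0 a (x%:Z - 1) `|`
     lobes false ((sumn a)%:Z + (y + z)%N%:Z) (rev b) (x%:Z - 1))%fset.
  rewrite /P_upper lobes_cat /a -cats1 lobes_cat odd_a /= fsetU0 add0r fset0U /b rev_rcons /=.
  rewrite !fset0U fsetU0 sumn_cat /= addn0; congr (_ `|` lobes _ _ _ _)%fset; lia.
rewrite in_P in_hexagon_P in_fsetU in_mirror !in_dented_half lobes_d lobes_u.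
rewrite {2}/refl !in_trapezoid sum_u sum_d.
have [hx|hx] := ltrP h x%:Z.
  rewrite !in_left_fern_below // !in_fsetU !in_trapezoid.
  by rewrite !sumn_osum_esum; case: o => /=; lia.
have -> : (h <= x%:Z - 1) = false by lia.
rewrite !in_left_fern_above // !in_fsetU andbF /= andbF orbF.
rewrite !sumn_osum_esum negb_or.
case: (_ \notin _); case: (_ \notin _); rewrite ?andbF ?andbT //=.
by case: o => /=; lia.
Qed.

Lemma P_upper_blocks : blocks true 0 P_upper =
  blocks true 0 a ++ blocks false ((sumn a)%:Z + (y + z)%N%:Z) (rev b).
Proof.
rewrite /P_upper blocks_cat /a -cats1 blocks_cat odd_a /= cats0 add0r /b rev_rcons /=.
rewrite sumn_cat /= addn0; congr (_ ++ blocks _ _ _); lia.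
Qed.

Lemma P_lower_blocks : blocks true (- x%:Z) P_lower =
  irange (- x%:Z) x ++ blocks false 0 a ++
  blocks true ((sumn a)%:Z + (y + z)%N%:Z) (rev b) ++
  irange ((sumn a)%:Z + (y + z)%N%:Z + (sumn b)%:Z) t.
Proof.
rewrite /P_lower -cats1 /= addNr blocks_cat /= size_rcons /= odd_a add0r.
by rewrite blocks_cat size_rev size_rcons /= odd_b sumn_rev cats0.
Qed.

(** The eastern vertex now lies [t] rows above the axis, so the triangle of side [t] completes the
    upper half. The gap absorbs the last lobe of the left fern from above and that of the right fern
    from below. *)
Definition Q_upper : seq nat := a' ++ (k + y + z)%N :: rcons (rev b) t.
Definition Q_lower : seq nat := x :: a ++ (y + z + m)%N :: rev b'.

Lemma in_hexagon_Q (i h : int) o :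
  inside (in_hexagon (Q_sides x y z t a b)) ((i, h), o) =
  [&& 0 <= i, h < (x + y + t + osum a + esum b)%N%:Z,
      i + h + (~~ o)%:Z < (x + y + z + t + sumn a + sumn b)%N%:Z,
      i < (y + z + sumn a + sumn b)%N%:Z,
      - (y + esum a + osum b)%N%:Z <= h & 0 <= i + h + (~~ o)%:Z].
Proof.
rewrite /inside /in_hexagon /right_of /= !cornerS corner0 !mulrn_point !sumn_osum_esum /=.
by case: o => /=; lia.
Qed.

Lemma in_Q (i h : int) o : (((i, h), o) \in Q x y z t a b) =
  [&& inside (in_hexagon (Q_sides x y z t a b)) ((i, h), o),
      ~~ in_left_fern true (0, x%:Z) a ((i, h), o) &
      ~~ in_left_fern true ((sumn a)%:Z + (y + z)%N%:Z, x%:Z) (rev b) ((i, h), o)].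
Proof.
rewrite [LHS]in_fset [LHS]inE mem_hexagon //; last by case: (corner_Q x y z t a b).
rewrite in_right_fern_rev size_rcons /= negbK odd_b.
suff -> : (Q_right x y z t a b).1 - (sumn b)%:Z = (sumn a)%:Z + (y + z)%N%:Z by [].
rewrite /Q_right !cornerS corner0 !mulrn_point /= !sumn_osum_esum; lia.
Qed.

Lemma Q_halves : Q x y z t a b =
  (mirror x (dented_half 0 Q_upper (x%:Z - 1) (y + t + osum a + esum b)) `|`
   dented_half (- x%:Z) Q_lower (x%:Z - 1) (x + y + esum a + osum b))%fset.
Proof.
apply: triangle_fsetP => i h o.
have sum_u : sumn Q_upper = (sumn a + sumn b + y + z + t)%N.
  by rewrite sumn_cat /= !sumn_rcons sumn_rev !sumn_rcons; lia.
have sum_d : sumn Q_lower = (x + sumn a + sumn b + y + z)%N.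
  by rewrite /= sumn_cat /= sumn_rev !sumn_rcons; lia.
have lobes_u : lobes true 0 Q_upper (x%:Z - 1) =
    (lobes true 0 a (x%:Z - 1) `|`
     (lobes true ((sumn a)%:Z + (y + z)%N%:Z) (rev b) (x%:Z - 1) `|`
      trapezoid ((sumn a)%:Z + (y + z)%N%:Z + (sumn b)%:Z) t (x%:Z - 1) t))%fset.
  rewrite /Q_upper lobes_cat {1}/a -(cats1 a') lobes_cat odd_a /= add0r fset0U.
  rewrite -(cats1 (rev b)) lobes_cat size_rev size_rcons /= odd_b sumn_rev !fsetU0 /a.
  suff -> : (sumn a')%:Z + (k + y + z)%N%:Z = (sumn (rcons a' k))%:Z + (y + z)%N%:Z by [].
  by rewrite sumn_rcons; lia.
have lobes_d : lobes true (- x%:Z) Q_lower (x%:Z - 1) =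
    (trapezoid (- x%:Z) x (x%:Z - 1) x `|` lobes false 0 a (x%:Z - 1) `|`
     lobes false ((sumn a)%:Z + (y + z)%N%:Z) (rev b) (x%:Z - 1))%fset.
  rewrite /Q_lower /= addNr lobes_cat /= size_rcons /= odd_a fset0U add0r /b rev_rcons /=.
  by rewrite !fset0U fsetUA; congr (_ `|` lobes _ _ _ _)%fset; lia.
rewrite in_Q in_hexagon_Q in_fsetU in_mirror !in_dented_half lobes_d lobes_u.
rewrite {2}/refl !in_trapezoid sum_u sum_d.
have [hx|hx] := ltrP h x%:Z.
  rewrite !in_left_fern_below // !in_fsetU !in_trapezoid.
  by rewrite !sumn_osum_esum; case: o => /=; lia.
have -> : (h <= x%:Z - 1) = false by lia.
rewrite !in_left_fern_above // !in_fsetU andbF /= andbF orbF !in_trapezoid.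
rewrite !sumn_osum_esum !negb_or.
case: (_ \notin _); case: (_ \notin _); rewrite ?andbF ?andbT //=.
by case: o => /=; lia.
Qed.

Lemma Q_upper_blocks : blocks true 0 Q_upper =
  blocks true 0 a ++ blocks true ((sumn a)%:Z + (y + z)%N%:Z) (rev b) ++
  irange ((sumn a)%:Z + (y + z)%N%:Z + (sumn b)%:Z) t.
Proof.
rewrite /Q_upper blocks_cat {1}/a -(cats1 a') blocks_cat odd_a /= add0r.
rewrite -(cats1 (rev b)) blocks_cat size_rev size_rcons /= odd_b sumn_rev !cats0 /a.
rewrite sumn_rcons; congr (_ ++ blocks _ _ _ ++ irange _ _); lia.
Qed.

Lemma Q_lower_blocks : blocks true (- x%:Z) Q_lower =
  irange (- x%:Z) x ++ blocks false 0 a ++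
  blocks false ((sumn a)%:Z + (y + z)%N%:Z) (rev b).
Proof.
rewrite /Q_lower /= addNr blocks_cat /= size_rcons /= odd_a add0r /b rev_rcons /=.
congr (_ ++ _ ++ blocks _ _ _); lia.
Qed.

(** Here the shapes of the ferns disappear: once the two halves share out the segments off the gap,
    the union of their dents remembers only total lengths. *)
Lemma perm_outside (U V : seq int) :
    let q := (sumn a)%:Z + (y + z)%N%:Z in
    perm_eq (U ++ V) (irange (- x%:Z) x ++ (blocks true 0 a ++ blocks false 0 a) ++
      (blocks true q (rev b) ++ blocks false q (rev b)) ++ irange (q + (sumn b)%:Z) t) ->
  perm_eq (U ++ V) (irange (- x%:Z) (x + sumn a) ++ irange q (sumn b + t)).
Proof.
move=> q; move/perm_trans; apply; apply/permP => f.
have /permP/(_ f) := perm_blocks 0 a; have /permP/(_ f) := perm_blocks q (rev b).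
rewrite !irange_cat addNr sumn_rev !count_cat; by move=> -> ->; rewrite !addnA.
Qed.

Let osum_esum_rev_b : osum (rev b) = esum b /\ esum (rev b) = osum b.
Proof. by have [-> ->] := osum_esum_rev b; rewrite size_rcons /= odd_b. Qed.

Lemma osum_P_upper : osum P_upper = (osum a + osum b)%N.
Proof.
have [ob eb] := osum_esum_rev_b.
by rewrite -(size_blocks true 0) P_upper_blocks size_cat !size_blocks eb.
Qed.

Lemma osum_P_lower : osum P_lower = (esum a + esum b + x + t)%N.
Proof.
have [ob eb] := osum_esum_rev_b.
rewrite -(size_blocks true (- x%:Z)) P_lower_blocks !size_cat !size_blocks !size_irange ob; lia.
Qed.

Lemma osum_Q_upper : osum Q_upper = (osum a + esum b + t)%N.
Proof.
have [ob eb] := osum_esum_rev_b.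
by rewrite -(size_blocks true 0) Q_upper_blocks !size_cat !size_blocks size_irange ob addnA.
Qed.

Lemma osum_Q_lower : osum Q_lower = (esum a + osum b + x)%N.
Proof.
have [ob eb] := osum_esum_rev_b.
rewrite -(size_blocks true (- x%:Z)) Q_lower_blocks !size_cat !size_blocks !size_irange eb; lia.
Qed.

Lemma M_P_halves :
  let U := blocks true 0 P_upper in let V := blocks true (- x%:Z) P_lower in
  (M (P x y z t a b))%:R = vdm U * vdm V /
    (H (osum a + osum b + y) * H (esum a + esum b + x + t + y)) *
  gap_sum (sumn a)%:Z (y + z) y (irange (- x%:Z) (x + sumn a) ++
    irange ((sumn a)%:Z + (y + z)%N%:Z) (sumn b + t)).
Proof.
move=> U V; have UV := P_upper_blocks; have VV := P_lower_blocks.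
have sU : size U = (osum a + osum b)%N by rewrite size_blocks osum_P_upper.
have sV : size V = (esum a + esum b + x + t)%N by rewrite size_blocks osum_P_lower.
rewrite P_halves (@M_two_halves _ _ _ (sumn a)%:Z _ _ _ _ (y + z) y) -/U -/V; first 1 last.
- move=> i; rewrite -/U -/V.
  (* A segment of a fern is the base of a lobe pointing up or down, hence dented in one half; the
     segments open in both halves lie between the ferns. *)
  have /perm_mem/(_ i) := perm_blocks 0 a.
  have /perm_mem/(_ i) := perm_blocks ((sumn a)%:Z + (y + z)%N%:Z) (rev b).
  rewrite /U /V UV VV !mem_cat !mem_irange sumn_rev.
  have -> : sumn P_upper = (sumn a + sumn b + y + z)%N.
    by rewrite sumn_cat /= sumn_rev !sumn_rcons; lia.
  have -> : sumn P_lower = (x + sumn a + sumn b + y + z + t)%N.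
    by rewrite /= sumn_cat /= sumn_rcons sumn_rev; lia.
  by case: (_ \in blocks _ _ _); case: (_ \in blocks _ _ _);
    case: (_ \in blocks _ _ _); case: (_ \in blocks _ _ _) => /=; lia.
- by rewrite sU; lia.
- by rewrite sV; lia.
- by lia.
rewrite (@sum_dent_counts _ _ _ _ _ (irange (- x%:Z) (x + sumn a) ++
    irange ((sumn a)%:Z + (y + z)%N%:Z) (sumn b + t))) ?sU ?sV //.
apply: perm_outside; rewrite /U /V UV VV; apply/permP => f; rewrite !count_cat; lia.
Qed.

Lemma M_Q_halves :
  let U := blocks true 0 Q_upper in let V := blocks true (- x%:Z) Q_lower in
  (M (Q x y z t a b))%:R = vdm U * vdm V /
    (H (osum a + esum b + t + y) * H (esum a + osum b + x + y)) *
  gap_sum (sumn a)%:Z (y + z) y (irange (- x%:Z) (x + sumn a) ++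
    irange ((sumn a)%:Z + (y + z)%N%:Z) (sumn b + t)).
Proof.
move=> U V; have UV := Q_upper_blocks; have VV := Q_lower_blocks.
have sU : size U = (osum a + esum b + t)%N by rewrite size_blocks osum_Q_upper.
have sV : size V = (esum a + osum b + x)%N by rewrite size_blocks osum_Q_lower.
rewrite Q_halves (@M_two_halves _ _ _ (sumn a)%:Z _ _ _ _ (y + z) y) -/U -/V; first 1 last.
- move=> i; rewrite -/U -/V.
  have /perm_mem/(_ i) := perm_blocks 0 a.
  have /perm_mem/(_ i) := perm_blocks ((sumn a)%:Z + (y + z)%N%:Z) (rev b).
  rewrite /U /V UV VV !mem_cat !mem_irange sumn_rev.
  have -> : sumn Q_upper = (sumn a + sumn b + y + z + t)%N.
    by rewrite sumn_cat /= !sumn_rcons sumn_rev !sumn_rcons; lia.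
  have -> : sumn Q_lower = (x + sumn a + sumn b + y + z)%N.
    by rewrite /= sumn_cat /= sumn_rev !sumn_rcons; lia.
  by case: (_ \in blocks _ _ _); case: (_ \in blocks _ _ _);
    case: (_ \in blocks _ _ _); case: (_ \in blocks _ _ _) => /=; lia.
- by rewrite sU; lia.
- by rewrite sV; lia.
- by lia.
rewrite (@sum_dent_counts _ _ _ _ _ (irange (- x%:Z) (x + sumn a) ++
    irange ((sumn a)%:Z + (y + z)%N%:Z) (sumn b + t))) ?sU ?sV //.
apply: perm_outside; rewrite /U /V UV VV; apply/permP => f; rewrite !count_cat; lia.
Qed.

End Regions.

(** * Padding the ferns with empty lobes *)

Lemma inside_empty_lobe b (p : point) u : inside (in_lobe b p 0) u = false.
Proof.
case: u => [[i h] o]; rewrite /inside /in_lobe; case: b; case: o => /=; lia.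
Qed.

Lemma in_left_fern_rcons0 b p c u : in_left_fern b p (rcons c 0%N) u = in_left_fern b p c u.
Proof.
by rewrite -cats1 in_left_fern_cat in_left_fern_cons inside_empty_lobe !orbF.
Qed.

Lemma in_right_fern_rcons0 b p c u :
  in_right_fern b p (rcons c 0%N) u = in_right_fern b p c u.
Proof.
rewrite !in_right_fern_rev rev_rcons in_left_fern_cons inside_empty_lobe /=.
rewrite size_rcons sumn_rcons addn0 addr0 /=.
by case: b; case: odd.
Qed.

Lemma osum_rcons0 c : osum (rcons c 0%N) = osum c.
Proof. by have [-> _] := osum_esum_rcons c 0; rewrite muln0 addn0. Qed.

Lemma esum_rcons0 c : esum (rcons c 0%N) = esum c.
Proof. by have [_ ->] := osum_esum_rcons c 0; rewrite muln0 addn0. Qed.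

Lemma P_rcons0 x y z t a b : P x y z t (rcons a 0%N) b = P x y z t a b /\
  P x y z t a (rcons b 0%N) = P x y z t a b.
Proof.
split; apply/fsetP => u; rewrite [LHS]in_fset [RHS]in_fset [LHS]inE [RHS]inE;
  rewrite /P_right /P_sides ?osum_rcons0 ?esum_rcons0;
  by rewrite ?in_left_fern_rcons0 ?in_right_fern_rcons0.
Qed.

Lemma Q_rcons0 x y z t a b : Q x y z t (rcons a 0%N) b = Q x y z t a b /\
  Q x y z t a (rcons b 0%N) = Q x y z t a b.
Proof.
split; apply/fsetP => u; rewrite [LHS]in_fset [RHS]in_fset [LHS]inE [RHS]inE;
  rewrite /Q_right /Q_sides ?osum_rcons0 ?esum_rcons0;
  by rewrite ?in_left_fern_rcons0 ?in_right_fern_rcons0.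
Qed.

Lemma even_padP (A : Type) (F : seq nat -> A) c :
    (forall c, F (rcons c 0%N) = F c) -> F (even_pad c) = F c.
Proof.
move=> F0; case: c => [|k c] /=; last by case: ifP; rewrite // -rcons_cons F0.
by rewrite (F0 [:: 0%N]) (F0 [::]).
Qed.

Lemma even_pad_rcons c : exists c' k, even_pad c = rcons c' k /\ odd (size c').
Proof.
case/lastP: c => [|c k]; first by exists [:: 0%N], 0%N.
have -> : even_pad (rcons c k) = if odd (size (rcons c k)) then rcons (rcons c k) 0%N
                                 else rcons c k by case: c.
rewrite size_rcons; case: ifP => oc; first by exists (rcons c k), 0%N; rewrite size_rcons.
by exists c, k; split=> //; apply: negbFE; rewrite -oddS.
Qed.

(* Both sides are the same hexagon, the axis being moved up to its northern side. *)
Lemma P_no_ferns x y z t :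
  P x y z t [:: 0; 0]%N [:: 0; 0]%N = P (x + y) 0 z (t + y) [:: 0; 0]%N [:: 0; 0]%N.
Proof.
apply: triangle_fsetP => i h o.
have nofern b p u : in_left_fern b p (rcons [:: 0%N] 0%N) u = false.
  by rewrite !in_left_fern_cons !inside_empty_lobe.
rewrite -[[:: 0; 0]%N]/(rcons [:: 0%N] 0%N) !in_P // !in_hexagon_P //.
rewrite -[rev _]/(rcons [:: 0%N] 0%N) !nofern //=.
by rewrite !(osum_cons, esum_cons, osum_nil, esum_nil) /=; lia.
Qed.

(** * Evaluation of the gap sum and the product formulas *)

Lemma gap_sum_value (q : int) l y z r :
  gap_sum q (y + z) y (irange (q - l%:Z) l ++ irange (q + (y + z)%N%:Z) r) =
  H y * H z * H (l + r + 2 * y + z) / (H (y + z) * H (l + r + 2 * y)) *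
  (H (l + r + y) / H (l + r + y + z)) * (H (l + y) * H (r + y) / (H l * H r)).
Proof.
rewrite !irange_shift -map_cat gap_sum_shift.
have := @M_P_halves l y z r [:: 0%N] [:: 0%N] 0 0 isT isT.
(* The same tilings are counted with the axis in its northern position, where no segment of the gap
   is crossed and the gap sum is 1. *)
rewrite /= P_no_ferns (@M_P_halves _ _ _ _ [:: 0%N] [:: 0%N] 0 0) //=.
rewrite !(osum_cons, esum_cons, osum_nil, esum_nil) !addn0 !add0n gap_sum0 mulr1.
rewrite !cats0 !addr0 !add0r !vdm_two_blocks.
have -> : vdm [::] = 1 by rewrite /vdm big_nil.
have -> : hyperfact 0 = 1%N by rewrite /hyperfact big_ord0.
have -> : (l + y + z + (r + y) = l + r + 2 * y + z)%N by lia.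
have -> : (l + y + (r + y) = l + r + 2 * y)%N by lia.
have -> : (z + (r + y) = y + z + r)%N by lia.
have -> : (l + (y + z) + r = l + r + y + z)%N by lia.
rewrite [(l + (y + z))%N]addnA; move: (gap_sum _ _ _ _) => G E.
(* The factor divided out is the coefficient of the gap sum for the original axis: without ferns [U]
   is empty and [V] consists of two runs. *)
apply: (@mulfI _ (1 * (H l * H r * (H (l + r + y + z) * H (y + z) /
  (H (l + y + z) * H (y + z + r)))) / (H y * H (l + r + y)))).
  by rewrite !mulf_neq0 ?invr_neq0 ?mulf_neq0 ?oner_neq0 ?hyperfact_neq0.
by rewrite -E; field; rewrite !hyperfact_neq0.
Qed.

Lemma but_last_rcons c k : but_last (rcons c k) = c.
Proof. by rewrite /but_last size_rcons /= -cats1 take_size_cat. Qed.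

Lemma gap_sum_halves x y z t A B :
  gap_sum A%:Z (y + z) y (irange (- x%:Z) (x + A) ++ irange (A%:Z + (y + z)%N%:Z) (B + t)) =
  H y * H z * H (A + B + x + 2 * y + z + t) / (H (y + z) * H (A + B + x + 2 * y + t)) *
  (H (A + B + x + y + t) / H (A + B + x + y + z + t)) *
  (H (A + x + y) * H (B + y + t) / (H (A + x) * H (B + t))).
Proof.
have -> : - x%:Z = A%:Z - (x + A)%N%:Z by lia.
rewrite gap_sum_value [(x + A)%N]addnC.
have -> : (A + x + (B + t) + 2 * y + z = A + B + x + 2 * y + z + t)%N by lia.
have -> : (A + x + (B + t) + 2 * y = A + B + x + 2 * y + t)%N by lia.
have -> : (A + x + (B + t) + y + z = A + B + x + y + z + t)%N by lia.
have -> : (A + x + (B + t) + y = A + B + x + y + t)%N by lia.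
by have -> : (B + t + y = B + y + t)%N by lia.
Qed.

Lemma M_P x y z t a' k b' m : odd (size a') -> odd (size b') ->
  (M (P x y z t (rcons a' k) (rcons b' m)))%:R =
  Phi_even x y z t (rcons a' k) (rcons b' m).
Proof.
move=> oa ob; rewrite M_P_halves // gap_sum_halves /Phi_even !last_rcons !but_last_rcons.
rewrite -/(P_upper y z a' b' k m) -/(P_lower x y z t a' b' k m).
(* Both lists have odd length because [a'] and [b'] do, so each [s] becomes a Vandermonde product
   over a hyperfactorial. *)
rewrite (@s_blocks 0 (P_upper _ _ _ _ _ _)); last first.
  by rewrite size_cat /= size_rev oddD /= oa ob.
rewrite (@s_blocks (- x%:Z) (P_lower _ _ _ _ _ _ _ _)); last first.
  by rewrite /= size_cat /= !size_rcons size_rev size_rcons oddD /= oa ob.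
rewrite osum_P_upper // osum_P_lower //.
have -> : (esum (rcons a' k) + esum (rcons b' m) + x + y + t =
  esum (rcons a' k) + esum (rcons b' m) + x + t + y)%N by lia.
by field; rewrite !hyperfact_neq0.
Qed.

Lemma M_Q x y z t a' k b' m : odd (size a') -> odd (size b') ->
  (M (Q x y z t (rcons a' k) (rcons b' m)))%:R =
  Psi_even x y z t (rcons a' k) (rcons b' m).
Proof.
move=> oa ob; rewrite M_Q_halves // gap_sum_halves /Psi_even !last_rcons !but_last_rcons.
rewrite -/(Q_upper y z t a' b' k m) -/(Q_lower x y z a' b' k m).
rewrite (@s_blocks 0 (Q_upper _ _ _ _ _ _ _)); last first.
  by rewrite size_cat /= size_rcons size_rev size_rcons oddD /= oa ob.
rewrite (@s_blocks (- x%:Z) (Q_lower _ _ _ _ _ _ _)); last first.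
  by rewrite /= size_cat /= !size_rcons size_rev oddD /= oa ob.
rewrite osum_Q_upper // osum_Q_lower //.
have -> : (osum (rcons a' k) + esum (rcons b' m) + y + t =
  osum (rcons a' k) + esum (rcons b' m) + t + y)%N by lia.
by field; rewrite !hyperfact_neq0.
Qed.

Theorem theorem2p1 (x y z t : nat) (a b : seq nat) :
  ((M (P x y z t a b))%:R = Phi x y z t a b :> rat)%R /\
  ((M (Q x y z t a b))%:R = Psi x y z t a b :> rat)%R.
Proof.
have [a' [k [Ea oa]]] := even_pad_rcons a; have [b' [m [Eb ob]]] := even_pad_rcons b.
(* Padding changes neither region, so both ferns may be taken with a positive even number of
   lobes. *)
rewrite /Phi /Psi -(even_padP (F := fun c => P x y z t c b)); last first.
  by move=> c; case: (P_rcons0 x y z t c b).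
rewrite -(even_padP (F := P x y z t (even_pad a))); last first.
  by move=> c; case: (P_rcons0 x y z t (even_pad a) c).
rewrite -(even_padP (F := fun c => Q x y z t c b)); last first.
  by move=> c; case: (Q_rcons0 x y z t c b).
rewrite -(even_padP (F := Q x y z t (even_pad a))); last first.
  by move=> c; case: (Q_rcons0 x y z t (even_pad a) c).
by rewrite Ea Eb; split; [apply: M_P | apply: M_Q].
Qed.
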